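(* Let $T$ be a closed normal operator on a complex Hilbert space $H$ and let $A$ be a linear operator on $H$ with $\mathcal D(T)\subseteq\mathcal D(A)$ such that, for some constants $a\ge 0$ and $0\le b<1$, $\|Ax\|^2\le a^2\|x\|^2+b^2\|Tx\|^2$ for all $x\in\mathcal D(T)$. Assume that $\sigma(T)\subseteq\{z\in\mathbb C:\gamma_1\le\operatorname{Im} z\le\gamma_2\}$ for some real $\gamma_1<\gamma_2$, and set $\widetilde\gamma=\max\{|\gamma_1|,|\gamma_2|\}$. Then $$(\mathrm i\gamma_1-\mathrm{Hyp}_{\widetilde\gamma})\cup(\mathrm i\gamma_2+\mathrm{Hyp}_{\widetilde\gamma})\subseteq\rho(T+A),$$ and for all $z$ in the set on the left hand side $$\|(T+A-z)^{-1}\|\le\frac{1}{|\operatorname{Im} z-\gamma|-\sqrt{b^2\big(|\operatorname{Im} z-\gamma|^2+(\operatorname{Re} z)^2\big)+a^2+b^2\widetilde\gamma^2}},$$ where $\gamma=\gamma_1$ if $\operatorname{Im} z<\gamma_1$ and $\gamma=\gamma_2$ if $\operatorname{Im} z>\gamma_2$.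
   Context: $\mathcal D(S)$ denotes the domain of an operator $S$. A closed densely defined operator $T$ on $H$ is normal if $TT^*=T^*T$. The operator $T+A$ has domain $\mathcal D(T)$. The resolvent set $\rho(S)$ is the set of $z\in\mathbb C$ such that $S-z:\mathcal D(S)\to H$ is bijective with bounded inverse; $\sigma(S)=\mathbb C\setminus\rho(S)$. For $\gamma\in\mathbb R$ (and the given $a,b$), $$\mathrm{Hyp}_\gamma=\Big\{z\in\mathbb C:\ \frac{a^2+b^2\gamma^2}{1-b^2}+\frac{b^2(\operatorname{Re} z)^2}{1-b^2}<(\operatorname{Im} z)^2,\ \operatorname{Im} z>0\Big\},$$ and $w_0\pm\mathrm{Hyp}_\gamma=\{w_0\pm w: w\in\mathrm{Hyp}_\gamma\}$ for $w_0\in\mathbb C$. *)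

(* Defs.v *)
From HB Require Import structures.
From mathcomp Require Import all_boot all_order all_algebra.
From mathcomp Require Import complex sesquilinear.
From mathcomp Require Import all_classical all_reals all_analysis.

Set Implicit Arguments.
Unset Strict Implicit.
Unset Printing Implicit Defensive.

Import Order.TTheory GRing.Theory Num.Theory.
Import numFieldNormedType.Exports.

Local Open Scope classical_set_scope.
Local Open Scope ring_scope.
Local Open Scope complex_scope.

(* A complex Hilbert space is a complete normed module [H] over [R[i]] with a
   positive definite Hermitian form, linear in its first argument, that induces
   the norm. *)
Definition induces_norm (R : realType) (H : completeNormedModType R[i])
    (inner : {dot H for Num.conj}) : Prop :=
  forall x : H, inner x x = `|x| ^+ 2.

(* The library norm of [H] takes its values in [R[i]]; they are nonnegative,
   hence have zero imaginary part. *)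
Definition rnorm (R : realType) (H : normedModType R[i]) (x : H) : R :=
  complex.Re `|x|.

(* The values of [op_fun] outside of [dom] are irrelevant: every notion below
   depends only on the domain and on the values there. *)
Record operator (H : Type) := Operator {
  dom : set H;
  op_fun :> H -> H
}.

Definition op_eq (H : Type) (S T : operator H) : Prop :=
  dom S = dom T /\ (forall x, dom S x -> S x = T x).

Definition op_comp (H : Type) (S T : operator H) : operator H :=
  Operator [set x | dom T x /\ dom S (T x)] (fun x => S (T x)).

Definition op_linear (K : nzRingType) (H : lmodType K) (S : operator H) :
    Prop :=
  [/\ dom S 0,
      (forall (c : K) (x y : H), dom S x -> dom S y -> dom S (c *: x + y)) &
      (forall (c : K) (x y : H), dom S x -> dom S y ->
         S (c *: x + y) = c *: S x + S y)].

Definition op_closed (H : topologicalType) (S : operator H) : Prop :=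
  closed [set p : H * H | dom S p.1 /\ p.2 = S p.1].

Definition densely_defined (H : topologicalType) (S : operator H) : Prop :=
  dense (dom S).

(* The vector [z] is unique when [T] is densely defined. *)
Definition adjoint (R : realType) (H : completeNormedModType R[i])
    (inner : {dot H for Num.conj}) (T : operator H) : operator H :=
  let adj_rel (y : H) : set H :=
    [set z | forall x, dom T x -> inner (T x) y = inner x z] in
  Operator [set y | adj_rel y !=set0] (fun y => xget 0 (adj_rel y)).

Definition op_normal (R : realType) (H : completeNormedModType R[i])
    (inner : {dot H for Num.conj}) (T : operator H) : Prop :=
  [/\ op_linear T, op_closed T, densely_defined T &
      op_eq (op_comp T (adjoint inner T)) (op_comp (adjoint inner T) T)].

(* The sum [T + A], used only when [dom T `<=` dom A]. *)
Definition perturb (K : nzRingType) (H : lmodType K) (T A : operator H) :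
    operator H :=
  Operator (dom T) (fun x => T x + A x).

Definition op_shift (K : nzRingType) (H : lmodType K) (S : operator H) (z : K) :
    operator H :=
  Operator (dom S) (fun x => S x - z *: x).

Definition resolvent (K : nzRingType) (H : lmodType K) (S : operator H)
    (z : K) : H -> H :=
  'pinv_(fun=> 0) (dom S) (op_shift S z).

Definition bounded_op (R : realType) (H : normedModType R[i]) (B : H -> H) :
    Prop :=
  exists M : R, forall x, rnorm (B x) <= M * rnorm x.

(* Supremum over the closed unit ball, in the extended reals: it is +oo when
   [B] is unbounded. *)
Definition opnorm (R : realType) (H : normedModType R[i]) (B : H -> H) :
    \bar R :=
  ereal_sup [set (rnorm (B x))%:E | x in [set x | rnorm x <= 1]].

Definition resolvent_set (R : realType) (H : normedModType R[i])
    (S : operator H) : set R[i] :=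
  [set z | set_bij (dom S) setT (op_shift S z) /\
           bounded_op (resolvent S z)].

Definition spectrum (R : realType) (H : normedModType R[i])
    (S : operator H) : set R[i] :=
  ~` resolvent_set S.

Definition Hyp (R : realType) (a b gamma : R) : set R[i] :=
  [set z | (a ^+ 2 + b ^+ 2 * gamma ^+ 2) / (1 - b ^+ 2)
             + b ^+ 2 * complex.Re z ^+ 2 / (1 - b ^+ 2)
           < complex.Im z ^+ 2
           /\ 0 < complex.Im z].

(* Main.v *)
Require Import Defs.
From mathcomp Require Import all_boot all_order all_algebra.
From mathcomp Require Import complex sesquilinear.
From mathcomp Require Import all_classical all_reals all_analysis.
From mathcomp Require Import ring lra.

Set Implicit Arguments.
Unset Strict Implicit.
Unset Printing Implicit Defensive.

Import Order.TTheory GRing.Theory Num.Theory.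
Import numFieldNormedType.Exports.

Local Open Scope classical_set_scope.
Local Open Scope ring_scope.
Local Open Scope complex_scope.

(** The theorem is a Neumann series argument: [T + A - z] factors through
    [T - z] as [(1 + A (T - z)^-1) (T - z)], so everything follows from
    [d |v| <= |(T - z) v|] and [|A v| <= q |(T - z) v|], where [d] is the
    distance from [z] to the strip and [q < 1]. The domain [Hyp] is exactly
    where the [q] found below is smaller than 1.

    With the spectral theorem both bounds would be suprema of explicit functions
    of a spectral variable. They are obtained here without it, from three facts.

    - A normal operator satisfies [dom T <= dom T^*] and [|T^* u| = |T u|]
      ([normal_adjoint]). On the domain of [T^* T] this is a computation; it
      passes to [u] in [dom T] along [u_e = (1 + e T^* T)^-1 u] as [e] tends
      to 0, because [T u_e] and [T^* u_e] converge in norm. The vectors [u_e]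
      are projections onto the graph of [T] ([graph_proj]).

    - If the open disc of centre [z] and radius [r] lies in the resolvent set,
      then [r |v| <= |(T - z) v|] ([normal_resolvent_ball]). Let [c] be the
      norm of [B = (T - z)^-1]. Normality makes [k |-> |B^k x|] log-convex
      ([normal_shift_log_convex]), so some [x] has [|B^k x|] close to
      [c^k |x|] for all [k] up to a large [N]. The vector
      [q = sum_(k < N) a^k B^(k+1) x] with [|a| = 1 / c] satisfies
      [(T - z - a) q = x - a^N B^N x] by telescoping, of norm at most [2 |x|],
      while [|q|] is of order [c sqrt N |x|] for a suitable phase of [a]
      ([exists_phase_sum_ge], a form of Parseval). Hence [z + a] is almost an
      eigenvalue, at distance [1 / c] from [z]. If [1 / c < r], iterating from
      [z + a] produces a Cauchy sequence of better and better approximate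
      eigenvalues, whose limit is a spectral point inside the disc.

    - Letting [z = i y] with [y] large of either sign, the disc bound turns the
      hypothesis on the spectrum into
      [gamma1 |v|^2 <= Im <T v, v> <= gamma2 |v|^2], hence into the bound
      [|(T - T^* ) v| <= 2 g |v|] with [g = max(|gamma1|, |gamma2|)], since
      [T - T^*] is a skew symmetric form.

    The parallelogram law splits [|T v|^2] and [|(T - z) v|^2] into the
    contributions of [T + T^*] and [T - T^*], and the relative bound of
    [A] by [T - z] ([relative_bound_resolvent]) becomes an inequality between
    four real numbers. *)

(** * The norm as a real number *)

Section RealNorm.
Variables (R : realType) (H : normedModType R[i]).
Implicit Types (x y : H) (z : R[i]).

Definition rabs z : R := complex.Re `|z|.

Lemma norm_rnorm x : `|x| = (rnorm x)%:C.
Proof.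
by apply/esym/RRe_real; rewrite ger0_real.
Qed.

Lemma rabsE z : `|z| = (rabs z)%:C.
Proof. by apply/esym/RRe_real; rewrite ger0_real. Qed.

Lemma rnorm_ge0 x : 0 <= rnorm x.
Proof. by rewrite -ler0c -norm_rnorm. Qed.

Lemma rabs_ge0 z : 0 <= rabs z.
Proof. by rewrite -ler0c -rabsE. Qed.

Lemma rabs_sqr z : rabs z ^+ 2 = complex.Re z ^+ 2 + complex.Im z ^+ 2.
Proof. by apply: complexI; rewrite rmorphXn/= -rabsE -add_Re2_Im2. Qed.

Lemma rabsR (c : R) : rabs c%:C = `|c|.
Proof. by rewrite /rabs normc_def /= expr0n addr0 sqrtr_sqr. Qed.

Lemma rabsM z z' : rabs (z * z') = rabs z * rabs z'.
Proof. by apply: complexI; rewrite rmorphM /= -!rabsE normrM. Qed.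

Lemma rabsX z n : rabs (z ^+ n) = rabs z ^+ n.
Proof. by apply: complexI; rewrite rmorphXn /= -!rabsE normrX. Qed.

Lemma rabsN z : rabs (- z) = rabs z.
Proof. by rewrite /rabs normrN. Qed.

Lemma rabs_leD z z' : rabs (z + z') <= rabs z + rabs z'.
Proof. by rewrite -lecR rmorphD /= -!rabsE ler_normD. Qed.

Lemma rnormZ z x : rnorm (z *: x) = rabs z * rnorm x.
Proof. by apply: complexI; rewrite rmorphM /= -rabsE -!norm_rnorm normrZ. Qed.

Lemma rnormD x y : rnorm (x + y) <= rnorm x + rnorm y.
Proof. by rewrite -lecR rmorphD /= -!norm_rnorm ler_normD. Qed.

Lemma rnormN x : rnorm (- x) = rnorm x.
Proof. by rewrite /rnorm normrN. Qed.

Lemma rnormB x y : rnorm (x - y) = rnorm (y - x).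
Proof. by rewrite -rnormN opprB. Qed.

Lemma rnorm0 : rnorm (0 : H) = 0.
Proof. by rewrite /rnorm normr0. Qed.

Lemma rnorm_eq0 x : (rnorm x == 0) = (x == 0).
Proof. by rewrite -(inj_eq (@complexI R)) -norm_rnorm normr_eq0. Qed.

Lemma rnorm_gt0 x : (0 < rnorm x) = (x != 0).
Proof. by rewrite lt_def rnorm_eq0 rnorm_ge0 andbT. Qed.

Lemma rnorm_dist x y w : rnorm (x - w) <= rnorm (x - y) + rnorm (y - w).
Proof. by rewrite -[x - w](subrKA y) rnormD. Qed.

Lemma ler_rnormB x y : rnorm x - rnorm y <= rnorm (x - y).
Proof. by rewrite lerBlDr -[x in leLHS](subrK y) rnormD. Qed.

(** * Convergence in the norm *)

(** Tolerances are real here, whereas the filters of [H] have complex radii. *)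
Definition seq_cvg (u : nat -> H) (l : H) :=
  forall e : R, 0 < e -> exists N, forall n, (N <= n)%N -> rnorm (u n - l) < e.

Definition seq_cauchy (u : nat -> H) :=
  forall e : R, 0 < e -> exists N, forall m n, (N <= m)%N -> (N <= n)%N ->
    rnorm (u m - u n) < e.

Lemma rnorm_lt (e : R) x : (`|x| < e%:C) = (rnorm x < e).
Proof. by rewrite norm_rnorm ltcR. Qed.

Lemma gt0_complexE z : 0 < z -> exists2 e : R, 0 < e & z = e%:C.
Proof.
move=> z0; exists (complex.Re z); last by rewrite RRe_real// gtr0_real.
by move: z0; rewrite ltcE => /andP[].
Qed.

Lemma seq_cvgP (u : nat -> H) l : seq_cvg u l <-> u @ \oo --> l.
Proof.
split=> [ul|/cvgrPdist_lt ul e e0].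
  apply/cvgrPdist_lt => _ /gt0_complexE [e e0 ->].
  have [N uN] := ul _ e0; exists N => // n /= Nn.
  by rewrite distrC rnorm_lt uN.
have /ul [N _ uN] : 0 < e%:C by rewrite ltcR.
by exists N => n Nn; rewrite rnormB -rnorm_lt; apply: uN.
Qed.

Lemma dense_approx (D : set H) x (e : R) :
  dense D -> 0 < e -> exists2 y, D y & rnorm (x - y) < e.
Proof.
move=> dD e0; have e0c : 0 < e%:C by rewrite ltcR.
have [||y []] := dD ((ball x e%:C)^°).
- by exists x; apply: nbhsx_ballx.
- exact: open_interior.
move=> /interior_subset; rewrite -ball_normE /= rnorm_lt => xy Dy.
by exists y.
Qed.

Lemma closed_graph (T : operator H) (u : nat -> H) x y :
  op_closed T -> (forall n, dom T (u n)) ->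
  seq_cvg u x -> seq_cvg (fun n => T (u n)) y -> dom T x /\ T x = y.
Proof.
move=> cT uD /seq_cvgP ux /seq_cvgP Tuy.
have uTu : (u n, T (u n)) @[n --> \oo] --> (x, y) by exact: cvg_pair.
have inG : \forall n \near \oo,
    [set p : H * H | dom T p.1 /\ p.2 = T p.1] (u n, T (u n)).
  by apply: nearW => n /=.
by have [/= ? ->] := closed_cvg _ cT inG _ uTu.
Qed.

End RealNorm.

Lemma seq_cauchy_cvg (R : realType) (H : completeNormedModType R[i])
  (u : nat -> H) : seq_cauchy u -> exists l, seq_cvg u l.
Proof.
move=> uc.
suff : cvg (u @ \oo) by exists (lim (u @ \oo)); apply/seq_cvgP.
apply/cauchy_cvgP/cauchy_exP => _ /gt0_complexE [e e0 ->].
have [N uN] := uc _ e0.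
by exists (u N), N => // n /= Nn; rewrite -ball_normE /= rnorm_lt uN.
Qed.

(** * The real inner product *)

Section RealInner.
Variables (R : realType) (H : completeNormedModType R[i]).
Variable inner : {dot H for Num.conj}.
Hypothesis inner_norm : induces_norm inner.
Implicit Types (x y w : H) (z : R[i]).

Definition re_inner x y : R := complex.Re (inner x y).
Local Notation rip := re_inner.

Lemma ReD z z' : complex.Re (z + z') = complex.Re z + complex.Re z'.
Proof. by case: z => ? ?; case: z' => ? ?; reflexivity. Qed.

Lemma ReN z : complex.Re (- z) = - complex.Re z.
Proof. by case: z => ? ?; reflexivity. Qed.

Lemma Re_conj z : complex.Re (Num.conj z) = complex.Re z.
Proof. by case: z. Qed.

Lemma ripC x y : rip x y = rip y x.
Proof. by rewrite /re_inner hermC expr0 mul1r Re_conj. Qed.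

Lemma ripDl x y w : rip (x + y) w = rip x w + rip y w.
Proof. by rewrite /re_inner linearDl ReD. Qed.

Lemma ripNl x w : rip (- x) w = - rip x w.
Proof. by rewrite /re_inner linearNl ReN. Qed.

Lemma ripBl x y w : rip (x - y) w = rip x w - rip y w.
Proof. by rewrite ripDl ripNl. Qed.

Lemma ripDr x y w : rip w (x + y) = rip w x + rip w y.
Proof. by rewrite ripC ripDl !(ripC w). Qed.

Lemma ripNr x w : rip w (- x) = - rip w x.
Proof. by rewrite ripC ripNl (ripC w). Qed.

Lemma ripBr x y w : rip w (x - y) = rip w x - rip w y.
Proof. by rewrite ripDr ripNr. Qed.

Lemma ripZl (c : R) x y : rip (c%:C *: x) y = c * rip x y.
Proof.
rewrite /re_inner linearZl_LR /=; case: (inner x y) => a b /=.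
by rewrite mul0r subr0.
Qed.

Lemma ripZr (c : R) x y : rip x (c%:C *: y) = c * rip x y.
Proof. by rewrite ripC ripZl ripC. Qed.

Lemma ripil x y : rip ('i *: x) y = - rip x ('i *: y).
Proof.
rewrite /re_inner linearZl_LR linearZr_LR /=; case: (inner x y) => a b /=.
by ring.
Qed.

(** The real part of the form determines it, which is why adjoints can be
    handled through [re_inner] alone. *)
Lemma Im_inner x y : complex.Im (inner x y) = rip x ('i *: y).
Proof.
rewrite /re_inner linearZr_LR /=; case: (inner x y) => a b /=.
by ring.
Qed.

Lemma ripxx x : rip x x = rnorm x ^+ 2.
Proof. by rewrite /re_inner inner_norm norm_rnorm -rmorphXn. Qed.

Lemma rnormD2 x y :
  rnorm (x + y) ^+ 2 = rnorm x ^+ 2 + 2 * rip x y + rnorm y ^+ 2.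
Proof. by rewrite -!ripxx ripDl !ripDr (ripC y x); ring. Qed.

Lemma rnormB2 x y :
  rnorm (x - y) ^+ 2 = rnorm x ^+ 2 - 2 * rip x y + rnorm y ^+ 2.
Proof. by rewrite -!ripxx ripBl !ripBr (ripC y x); ring. Qed.

Lemma parallelogram x y : rnorm (x + y) ^+ 2 + rnorm (x - y) ^+ 2 =
  2 * rnorm x ^+ 2 + 2 * rnorm y ^+ 2.
Proof. by rewrite rnormD2 rnormB2; ring. Qed.

Lemma rip_le x y : rip x y <= rnorm x * rnorm y.
Proof.
have : rnorm (x + y) ^+ 2 <= (rnorm x + rnorm y) ^+ 2.
  by rewrite ler_pXn2r ?nnegrE ?addr_ge0 ?rnorm_ge0 ?rnormD.
by rewrite rnormD2; lra.
Qed.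

Lemma rip_abs x y : `|rip x y| <= rnorm x * rnorm y.
Proof. by rewrite ler_norml rip_le lerNl -ripNl -(rnormN x) rip_le. Qed.

End RealInner.

(** * Limits of norms and inner products *)

(** The first-order condition at a minimum of a quadratic function. *)
Lemma quadratic_ge0_linear_coef (R : realFieldType) (b g : R) :
  (forall t, 0 <= t * b + t ^+ 2 * g) -> b = 0.
Proof.
move=> h; apply/eqP/contraT => b0.
have g0 : 0 < `|g| + 1 by rewrite ltr_wpDl.
(* Near 0 the linear term dominates; the shift by 1 keeps the point defined
   when [g] is 0. *)
have := h (- b / (`|g| + 1)); rewrite leNgt => /negP[].
rewrite (_ : _ + _ = b ^+ 2 / (`|g| + 1) ^+ 2 * (g - `|g| - 1)); last first.
  by field; rewrite gt_eqF.
rewrite pmulr_rlt0; first by have := ler_norm g; lra.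
by rewrite divr_gt0 ?exprn_even_gt0 ?exprn_gt0 ?b0 ?gt_eqF.
Qed.

Lemma invS_lt (R : realType) (e : R) : 0 < e ->
  exists N, forall n, (N <= n)%N -> n.+1%:R^-1 < e.
Proof.
move=> e0; have [N _ h] := near_infty_natSinv_lt (PosNum e0).
by exists N => n Nn; apply: h.
Qed.

Section SeqInner.
Variables (R : realType) (H : completeNormedModType R[i]).
Variable inner : {dot H for Num.conj}.
Hypothesis inner_norm : induces_norm inner.
Implicit Types (x y v w : H) (u : nat -> H).
Local Notation rip := (re_inner inner).

Lemma seq_cvg_rnorm u l :
  seq_cvg u l -> rnorm (u n) @[n --> \oo] --> rnorm l.
Proof.
move=> ul; apply/cvgrPdist_lt => e /ul [N uN].
exists N => // n /= /uN; apply: le_lt_trans.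
have := ler_rnormB (u n) l; have := ler_rnormB l (u n).
by rewrite (rnormB l) ler_norml; lra.
Qed.

Lemma seq_cvg_rip u l y :
  seq_cvg u l -> rip (u n) y @[n --> \oo] --> rip l y.
Proof.
move=> ul; apply/cvgrPdist_lt => e e0.
have y1 : 0 < rnorm y + 1 by rewrite ltr_wpDl ?rnorm_ge0.
have [|N uN] := ul (e / (rnorm y + 1)); first by rewrite divr_gt0.
exists N => // n /= /uN; rewrite ltr_pdivlMr// => /le_lt_trans; apply.
rewrite -ripBl (le_trans (rip_abs inner_norm _ _))//.
by rewrite rnormB ler_wpM2l ?rnorm_ge0// lerDl.
Qed.

Lemma seq_cauchy_sqr u :
  (forall e : R, 0 < e -> exists N, forall m n, (N <= m)%N -> (m <= n)%N ->
     rnorm (u n - u m) ^+ 2 < e) -> seq_cauchy u.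
Proof.
move=> h e e0; have [|N uN] := h (e ^+ 2); first by rewrite exprn_gt0.
exists N => m n Nm Nn; rewrite -(@ltr_pXn2r _ 2%N) ?nnegrE ?rnorm_ge0 ?ltW//.
by have [mn|/ltnW nm] := leqP m n; [rewrite rnormB|]; apply: uN.
Qed.

End SeqInner.

(** * Linear operators *)

Section LinearOperator.
Variables (R : realType) (H : completeNormedModType R[i]).
Variable T : operator H.
Hypothesis T_linear : op_linear T.
Implicit Types (x y : H) (c : R[i]).

Lemma dom0 : dom T 0. Proof. by case: T_linear. Qed.

Lemma domDZ c x y : dom T x -> dom T y -> dom T (c *: x + y).
Proof. by case: T_linear => _ h _; apply: h. Qed.

Lemma opDZ c x y : dom T x -> dom T y -> T (c *: x + y) = c *: T x + T y.
Proof. by case: T_linear => _ _; apply. Qed.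

Lemma op0 : T 0 = 0.
Proof.
have /eqP := opDZ 1 dom0 dom0; rewrite !scale1r addr0.
by rewrite -subr_eq0 opprD addNKr oppr_eq0 => /eqP.
Qed.

Lemma domD x y : dom T x -> dom T y -> dom T (x + y).
Proof. by move=> Dx; rewrite -[x]scale1r; apply: domDZ. Qed.

Lemma opD x y : dom T x -> dom T y -> T (x + y) = T x + T y.
Proof. by move=> Dx Dy; have := opDZ 1 Dx Dy; rewrite !scale1r. Qed.

Lemma domZ c x : dom T x -> dom T (c *: x).
Proof.
by move=> Dx; rewrite -[_ *: _]addr0; apply: domDZ => //; apply: dom0.
Qed.

Lemma opZ c x : dom T x -> T (c *: x) = c *: T x.
Proof. by move=> Dx; have := opDZ c Dx dom0; rewrite op0 !addr0. Qed.

Lemma domB x y : dom T x -> dom T y -> dom T (x - y).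
Proof. by move=> Dx Dy; rewrite -scaleN1r addrC; apply: domDZ. Qed.

Lemma opB x y : dom T x -> dom T y -> T (x - y) = T x - T y.
Proof.
by move=> Dx Dy; rewrite -scaleN1r addrC opDZ// scaleN1r addrC.
Qed.

Lemma dom_sum n (F : nat -> H) :
  (forall k, dom T (F k)) -> dom T (\sum_(k < n) F k).
Proof.
move=> DF; elim: n => [|n IH]; first by rewrite big_ord0; apply: dom0.
by rewrite big_ord_recr /=; apply: domD.
Qed.

Lemma op_sum n (F : nat -> H) : (forall k, dom T (F k)) ->
  T (\sum_(k < n) F k) = \sum_(k < n) T (F k).
Proof.
move=> DF; elim: n => [|n IH]; first by rewrite !big_ord0 op0.
by rewrite !big_ord_recr /= opD ?IH//; apply: dom_sum.
Qed.

End LinearOperator.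

(** * Projection onto the graph *)

Section GraphProjection.
Variables (R : realType) (H : completeNormedModType R[i]).
Variable inner : {dot H for Num.conj}.
Hypothesis inner_norm : induces_norm inner.
Variable T : operator H.
Hypothesis T_linear : op_linear T.
Hypothesis T_closed : op_closed T.
Implicit Types (x y v w : H).
Local Notation rip := (re_inner inner).

(** The vector [x] is [(1 + eps T^* T)^-1 u], and the conclusion says so in weak
    form: [T x] lies in the domain of the adjoint with value [(u - x) / eps].
    It minimises [|v - u|^2 + eps |T v|^2]: by the parallelogram law minimising
    sequences are Cauchy together with their images, the closed graph contains
    the limit, and the derivative at the minimum vanishes. *)
Lemma graph_proj u (eps : R) : 0 < eps ->
  exists2 x, dom T x &
    forall v, dom T v -> rip (u - x) v = eps * rip (T x) (T v).
Proof.
move=> eps0.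
pose F v := rnorm (v - u) ^+ 2 + eps * rnorm (T v) ^+ 2.
have F_ge0 v : 0 <= F v.
  by apply: addr_ge0; [|apply: mulr_ge0; first exact: ltW]; apply: sqr_ge0.
pose E := [set F v | v in dom T].
have infE : has_inf E.
  split; first by exists (F 0), 0 => //; apply: dom0.
  by exists 0 => _ [v _ <-].
have infF v : dom T v -> inf E <= F v.
  by move=> Dv; apply: ge_inf; [case: infE|exists v].
have /choice[a aP] (n : nat) : exists v, dom T v /\ F v < inf E + n.+1%:R^-1.
  have [|_ [v Dv <-] h] := @inf_adherent _ E n.+1%:R^-1 _ infE.
    by rewrite invr_gt0.
  by exists v.
have Da n : dom T (a n) by case: (aP n).
have Fa n : F (a n) < inf E + n.+1%:R^-1 by case: (aP n).
have FE x y : dom T x -> dom T y ->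
    F x + F y = 2 * F (2^-1%:C *: (x + y))
      + 2^-1 * (rnorm (x - y) ^+ 2 + eps * rnorm (T x - T y) ^+ 2).
  move=> Dx Dy; rewrite /F opZ ?opD//; last exact: domD.
  rewrite -!(ripxx inner_norm) !(ripBl, ripBr, ripDl, ripDr, ripZl, ripZr).
  rewrite (ripC _ y x) (ripC _ u x) (ripC _ u y) (ripC _ (T y) (T x)).
  by field.
have close m n : (m <= n)%N ->
    rnorm (a n - a m) ^+ 2 + eps * rnorm (T (a n) - T (a m)) ^+ 2
      <= 4 * m.+1%:R^-1.
  move=> mn; have := FE _ _ (Da n) (Da m).
  have := infF _ (domZ T_linear 2^-1%:C (domD T_linear (Da n) (Da m))).
  have : n.+1%:R^-1 <= m.+1%:R^-1 :> R by rewrite lef_pV2 ?posrE// ler_nat.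
  have := Fa m; have := Fa n.
  move: m.+1%:R^-1 n.+1%:R^-1 (F (a n)) (F (a m)) (F (_ *: _)) => ? ? ? ? ?.
  by lra.
have small (e : R) : 0 < e -> exists N, forall m n, (N <= m)%N -> (m <= n)%N ->
    rnorm (a n - a m) ^+ 2 + eps * rnorm (T (a n) - T (a m)) ^+ 2 < e.
  move=> e0; have [|N hN] := @invS_lt _ (e / 4); first by rewrite divr_gt0.
  exists N => m n Nm mn; apply: le_lt_trans (close _ _ mn) _.
  by move: (hN _ Nm); move: m.+1%:R^-1 => ?; lra.
have [x ax] : exists x, seq_cvg a x.
  apply/seq_cauchy_cvg/seq_cauchy_sqr => e /small[N hN].
  exists N => m n Nm mn; apply: le_lt_trans (hN _ _ Nm mn).
  by rewrite lerDl mulr_ge0// ?sqr_ge0// ltW.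
have [y Tay] : exists y, seq_cvg (T \o a) y.
  apply/seq_cauchy_cvg/seq_cauchy_sqr => e e0.
  have [|N hN] := small (eps * e); first by rewrite mulr_gt0.
  exists N => m n Nm mn; rewrite -(ltr_pM2l eps0).
  by apply: le_lt_trans (hN _ _ Nm mn); rewrite lerDr sqr_ge0.
have [Dx Txy] := closed_graph T_closed Da ax Tay.
have Fx : F x <= inf E.
  have cF : F (a n) @[n --> \oo] --> F x.
    rewrite /F Txy; apply: cvgD; [|apply: cvgMr]; rewrite ?expr2.
      under eq_fun do rewrite expr2.
      by apply: cvgM; apply: seq_cvg_rnorm => e /ax[N h]; exists N => n /h;
        rewrite opprB addrA subrK.
    under eq_fun do rewrite expr2.
    by apply: cvgM; apply: seq_cvg_rnorm.
  have c0 : inf E + n.+1%:R^-1 @[n --> \oo] --> inf E + 0.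
    apply: cvgD; first exact: cvg_cst.
    exact: cvg_harmonic.
  rewrite -[leRHS]addr0; apply: ler_cvg_to cF c0 _.
  by apply: nearW => n; apply: ltW.
exists x => // v Dv.
suff : 2 * (rip (x - u) v + eps * rip (T x) (T v)) = 0.
  by rewrite -opprB ripNl; lra.
apply: (@quadratic_ge0_linear_coef _ _ (rnorm v ^+ 2 + eps * rnorm (T v) ^+ 2)).
move=> t; have := infF _ (domDZ T_linear t%:C Dv Dx).
move: Fx; rewrite /F opDZ// -addrA.
rewrite -!(ripxx inner_norm) !(ripBl, ripBr, ripDl, ripDr, ripZl, ripZr).
rewrite (ripC _ v x) (ripC _ v u) (ripC _ u x) (ripC _ (T v) (T x)).
by lra.
Qed.

End GraphProjection.

(** * The adjoint of a normal operator *)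

Section NormalAdjoint.
Variables (R : realType) (H : completeNormedModType R[i]).
Variable inner : {dot H for Num.conj}.
Hypothesis inner_norm : induces_norm inner.
Variable T : operator H.
Hypothesis T_normal : op_normal inner T.
Implicit Types (x y v w : H).
Local Notation rip := (re_inner inner).

Let T_linear : op_linear T. Proof. by case: T_normal. Qed.
Let T_closed : op_closed T. Proof. by case: T_normal. Qed.
Let T_dense : densely_defined T. Proof. by case: T_normal. Qed.

(** The relation [T^* y = z]; stating it with real parts loses nothing because
    the domain is stable under multiplication by ['i]. *)
Definition adjoint_at y z := forall v, dom T v -> rip (T v) y = rip v z.

Lemma adjoint_at_inner y z : adjoint_at y z ->
  forall v, dom T v -> inner (T v) y = inner v z.
Proof.
move=> yz v Dv; apply/eqP; rewrite eq_complex.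
apply/andP; split; apply/eqP; first exact: yz.
have Div := domZ T_linear 'i Dv.
rewrite !Im_inner; apply: oppr_inj; rewrite -!ripil -(opZ T_linear)//.
exact: yz.
Qed.

Lemma inner_adjoint_at y z :
  (forall v, dom T v -> inner (T v) y = inner v z) -> adjoint_at y z.
Proof. by move=> yz v Dv; rewrite /re_inner yz. Qed.

Lemma adjoint_at_uniq y z z' : adjoint_at y z -> adjoint_at y z' -> z = z'.
Proof.
move=> yz yz'; apply/eqP; rewrite -subr_eq0 -rnorm_eq0.
rewrite eq_le rnorm_ge0 andbT; apply/ler_addgt0Pr => e e0; rewrite add0r.
have [v Dv vz] := dense_approx (z - z') T_dense e0.
have v0 : rip v (z - z') = 0 by rewrite ripBr -yz// -yz'// subrr.
have : rnorm (z - z') ^+ 2 <= rnorm (z - z') * e.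
  rewrite -(ripxx inner_norm) -[X in rip X _](subrK v) ripDl v0 addr0.
  rewrite (le_trans (rip_le inner_norm _ _))// mulrC ler_wpM2l ?rnorm_ge0//.
  exact: ltW.
rewrite expr2; have [->|n0] := eqVneq (rnorm (z - z')) 0.
  by move=> _; apply: ltW.
by rewrite ler_pM2l// lt_def n0 rnorm_ge0.
Qed.

Lemma adjoint_eq y z : adjoint_at y z ->
  dom (adjoint inner T) y /\ adjoint inner T y = z.
Proof.
move=> yz; have dy : dom (adjoint inner T) y.
  by exists z; apply: adjoint_at_inner.
split=> //; apply: adjoint_at_uniq yz; apply: inner_adjoint_at.
by have := xgetPex 0 dy.
Qed.

Lemma adjointP y : dom (adjoint inner T) y -> adjoint_at y (adjoint inner T y).
Proof. by move=> dy; apply: inner_adjoint_at; have := xgetPex 0 dy. Qed.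

(** How [T T^* = T^* T] is used: a vector in the domain of [T^* T], with
    [T^* T x = z], has an adjoint value [w] on which [T] gives [z] back. *)
Lemma normal_adjoint_swap x z : dom T x -> adjoint_at (T x) z ->
  exists w, [/\ dom T w, adjoint_at x w & T w = z].
Proof.
move=> Dx Txz; have [dTx eTx] := adjoint_eq Txz.
case: T_normal => _ _ _ [domE opE].
have : dom (op_comp (adjoint inner T) T) x by split.
rewrite -domE => -[dx Dw]; exists (adjoint inner T x); split => //.
  exact: adjointP.
have /= -> := opE x; last by split.
exact: eTx.
Qed.

Lemma normal_rnorm_adjoint x z w : dom T x -> adjoint_at (T x) z ->
  dom T w -> adjoint_at x w -> T w = z -> rnorm w = rnorm (T x).
Proof.
move=> Dx Txz Dw xw Tw.
apply/eqP; rewrite -(@eqrXn2 _ 2%N) ?rnorm_ge0// -!(ripxx inner_norm).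
by rewrite Txz// -xw// Tw ripC.
Qed.

Lemma adjoint_atB y y' z z' : adjoint_at y z -> adjoint_at y' z' ->
  adjoint_at (y - y') (z - z').
Proof. by move=> yz yz' v Dv; rewrite !ripBr yz// yz'. Qed.

(** With [x = (1 + e T^* T)^-1 u] and [y = (1 + d T^* T)^-1 u], the claim is
    [0 <= <T x, T (y - x)>], that is [0 <= <u - x, y - x>]. It follows from
    the positivity of [T^* T] tested on [y - x] and from [d < e], because
    [T^* T x = (u - x) / e] and [T^* T y = (u - y) / d]. *)
Lemma graph_proj_monotone u (e d : R) x y : 0 < d -> d < e ->
  dom T x -> dom T y ->
  (forall v, dom T v -> rip (u - x) v = e * rip (T x) (T v)) ->
  (forall v, dom T v -> rip (u - y) v = d * rip (T y) (T v)) ->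
  rnorm (T y - T x) ^+ 2 <= rnorm (T y) ^+ 2 - rnorm (T x) ^+ 2.
Proof.
move=> d0 de Dx Dy ex ey.
have e0 : 0 < e by exact: lt_trans de.
have Dyx := domB T_linear Dy Dx.
suff : 0 <= rip (T x) (T y - T x).
  rewrite (rnormB2 inner_norm) ripBr (ripxx inner_norm) (ripC _ (T y)).
  by lra.
rewrite -(opB T_linear)// -(pmulr_rge0 _ e0) -ex//.
have hx : rip (u - x) (y - x) = e * rip (T x) (T y - T x).
  by rewrite ex// (opB T_linear).
have hy : rip (u - y) (y - x) = d * rip (T y) (T y - T x).
  by rewrite ey// (opB T_linear).
have p : 0 <= rip (T y - T x) (T y - T x) by rewrite (ripxx inner_norm) sqr_ge0.
have q : 0 <= rip (y - x) (y - x) by rewrite (ripxx inner_norm) sqr_ge0.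
have r : rip (u - y) (y - x) = rip (u - x) (y - x) - rip (y - x) (y - x).
  by rewrite -ripBl opprB subrKA.
rewrite ripBl in p.
have pd : 0 <= e * d * (rip (T y) (T y - T x) - rip (T x) (T y - T x)).
  by rewrite !mulr_ge0// ltW.
have : 0 <= (e - d) * rip (u - x) (y - x).
  have -> : (e - d) * rip (u - x) (y - x) =
      e * d * (rip (T y) (T y - T x) - rip (T x) (T y - T x))
        + e * rip (y - x) (y - x).
    rewrite mulrBr -(mulrA e d) -hy -mulrA (mulrCA e d) -hx r; ring.
  by rewrite addr_ge0// mulr_ge0// ltW.
by rewrite pmulr_rge0// subr_gt0.
Qed.

(** The approximants [x n] have [T (x n)] in the domain of the adjoint, so the
    norms of [T] and of its adjoint agree on them and on their differences.
    The norms [|T (x n)|] increase and are bounded by [|T u|]; by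
    [graph_proj_monotone] this makes [T (x n)] a Cauchy sequence, and with it
    the adjoint values [w n]. *)
Lemma normal_adjoint u : dom T u ->
  exists2 w, adjoint_at u w & rnorm w = rnorm (T u).
Proof.
move=> Du; pose ep n : R := n.+1%:R^-1.
have ep0 n : 0 < ep n by rewrite invr_gt0.
have /choice[x xP] (n : nat) : exists x, dom T x /\
    (forall v, dom T v -> rip (u - x) v = ep n * rip (T x) (T v)).
  have [x Dx h] := graph_proj inner_norm T_linear T_closed u (ep0 n).
  by exists x.
have Dx n : dom T (x n) by case: (xP n).
have xE n : forall v, dom T v -> rip (u - x n) v = ep n * rip (T (x n)) (T v).
  by case: (xP n).
pose z n := ((ep n)^-1)%:C *: (u - x n).
have Txz n : adjoint_at (T (x n)) (z n).
  by move=> v Dv; rewrite ripZr ripC (ripC _ v) xE// mulKf// gt_eqF.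
have /choice[w wP] n := normal_adjoint_swap (Dx n) (Txz n).
have Dw n : dom T (w n) by case: (wP n).
have xw n : adjoint_at (x n) (w n) by case: (wP n).
have Tw n : T (w n) = z n by case: (wP n).
have wn n : rnorm (w n) = rnorm (T (x n)) by apply: normal_rnorm_adjoint (Tw n).
have wd m n : rnorm (w n - w m) = rnorm (T (x n) - T (x m)).
  rewrite -(opB T_linear)//; apply: (@normal_rnorm_adjoint _ (z n - z m)).
  - exact: domB.
  - by rewrite (opB T_linear)//; apply: adjoint_atB.
  - exact: domB.
  - exact: adjoint_atB.
  - by rewrite (opB T_linear)// !Tw.
have uxE n : rnorm (u - x n) ^+ 2 + ep n * rnorm (T (x n)) ^+ 2
    = ep n * rip (T (x n)) (T u).
  rewrite -!(ripxx inner_norm) ripBr !xE//; ring.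
have Tx_le n : rnorm (T (x n)) <= rnorm (T u).
  have [->|n0] := eqVneq (rnorm (T (x n))) 0; first exact: rnorm_ge0.
  have gn0 : 0 < rnorm (T (x n)) by rewrite lt_def n0 rnorm_ge0.
  rewrite -(ler_pM2l gn0); apply: le_trans (rip_le inner_norm _ _).
  rewrite -(ler_pM2l (ep0 n)) -uxE -expr2 lerDr; exact: sqr_ge0.
have ux n : rnorm (u - x n) ^+ 2 <= ep n * rnorm (T u) ^+ 2.
  have : ep n * rip (T (x n)) (T u) <= ep n * rnorm (T u) ^+ 2.
    rewrite ler_pM2l// (le_trans (rip_le inner_norm _ _))// expr2.
    by rewrite ler_wpM2r ?rnorm_ge0.
  apply: le_trans; rewrite -uxE lerDl; apply: mulr_ge0; last exact: sqr_ge0.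
  exact: ltW.
have mono m n : (m <= n)%N ->
    rnorm (T (x n) - T (x m)) ^+ 2
      <= rnorm (T (x n)) ^+ 2 - rnorm (T (x m)) ^+ 2.
  rewrite leq_eqVlt => /predU1P[->|mn].
    by rewrite !subrr rnorm0 expr0n.
  apply: (graph_proj_monotone (ep0 n) _ (Dx m) (Dx n) (xE m) (xE n)).
  by rewrite /ep ltf_pV2 ?posrE// ltr_nat.
pose g n := rnorm (T (x n)) ^+ 2.
have cg : cvgn g.
  apply: nondecreasing_is_cvgn.
    move=> m n mn; rewrite -subr_ge0; apply: le_trans (mono _ _ mn).
    exact: sqr_ge0.
  exists (rnorm (T u) ^+ 2) => _ [n _ <-].
  by rewrite /g ler_pXn2r ?nnegrE ?rnorm_ge0.
have gsmall (e : R) : 0 < e -> exists N, forall m n, (N <= m)%N -> (m <= n)%N ->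
    rnorm (T (x n) - T (x m)) ^+ 2 < e.
  move=> e0; have /cvgrPdist_lt/(_ (e / 2)) := cg.
  rewrite divr_gt0// => /(_ isT) [N _ hN]; exists N => m n Nm mn.
  apply: le_lt_trans (mono _ _ mn) _.
  have := hN _ Nm; have := hN _ (leq_trans Nm mn); rewrite /= /g !ltr_norml.
  by move=> /andP[? ?] /andP[? ?]; lra.
have [y Txy] : exists y, seq_cvg (T \o x) y.
  exact/seq_cauchy_cvg/seq_cauchy_sqr.
have [w0 ww0] : exists w0, seq_cvg w w0.
  apply/seq_cauchy_cvg/seq_cauchy_sqr => e /gsmall[N hN].
  by exists N => m n; rewrite wd; apply: hN.
have xu : seq_cvg x u.
  move=> e e0; have t0 : 0 < rnorm (T u) ^+ 2 + 1 by rewrite ltr_wpDl ?sqr_ge0.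
  have [|N hN] := @invS_lt _ (e ^+ 2 / (rnorm (T u) ^+ 2 + 1)).
    by rewrite divr_gt0 ?exprn_gt0.
  exists N => n /hN; rewrite ltr_pdivlMr// => h.
  rewrite -(@ltr_pXn2r _ 2%N) ?nnegrE ?rnorm_ge0 ?ltW// rnormB.
  apply: le_lt_trans (ux n) _; apply: le_lt_trans h.
  by rewrite ler_pM2l// lerDl.
have [_ Tu] := closed_graph T_closed Dx xu Txy.
exists w0.
  move=> v Dv; rewrite ripC (ripC _ v).
  have h1 := seq_cvg_rip inner_norm xu (y := T v).
  have h2 : rip (x n) (T v) @[n --> \oo] --> rip w0 v.
    under eq_fun do rewrite ripC xw// ripC.
    exact: seq_cvg_rip.
  exact: (norm_cvg_unique h1 h2).
have h1 : rnorm (w n) @[n --> \oo] --> rnorm y.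
  under eq_fun do rewrite wn.
  exact: seq_cvg_rnorm.
by rewrite Tu; apply: (norm_cvg_unique (seq_cvg_rnorm ww0) h1).
Qed.

(** Multiplication by [z] has the conjugate as its adjoint. *)
Lemma rip_conjl z x y : rip (z *: x) y = rip x (z^*%C *: y).
Proof.
rewrite /re_inner linearZl_LR linearZr_LR /=.
by case: z (inner x y) => [a b] [c d] /=; ring.
Qed.

Lemma normal_shift_adjoint u : dom T u -> exists2 w, adjoint_at u w &
  forall z, rnorm (w - z^*%C *: u) = rnorm (T u - z *: u).
Proof.
move=> Du; have [w uw wn] := normal_adjoint Du.
exists w => // z.
apply/eqP; rewrite -(@eqrXn2 _ 2%N) ?rnorm_ge0// !(rnormB2 inner_norm) wn.
rewrite ripC -uw; last exact: domZ.
by rewrite (opZ T_linear)// rip_conjl conjcK !rnormZ /rabs normcJ.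
Qed.

(** Cauchy-Schwarz for [<(T - z) w, (T - z) w> = <w, (T - z)^* (T - z) w>],
    where normality removes the star. Along an orbit of the resolvent it says
    that the norms form a log-convex sequence. *)
Lemma normal_shift_log_convex z w : dom T w -> dom T (T w - z *: w) ->
  rnorm (T w - z *: w) ^+ 2 <=
  rnorm w * rnorm (T (T w - z *: w) - z *: (T w - z *: w)).
Proof.
move=> Dw Du; have [s us <-] := normal_shift_adjoint Du.
by rewrite -(ripxx inner_norm) {1}ripBl us// rip_conjl -ripBr rip_le.
Qed.

End NormalAdjoint.

(** * Geometric sequences *)

Section Geometric.
Variable R : realType.

Lemma exprn_small (q e : R) : 0 <= q -> q < 1 -> 0 < e ->
  exists N, forall n, (N <= n)%N -> q ^+ n < e.
Proof.
move=> q0 q1 e0.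
have /cvgrPdist_lt/(_ _ e0)[N _ hN] : q ^+ n @[n --> \oo] --> 0.
  by apply: cvg_expr; rewrite ger0_norm.
exists N => n /hN /=; rewrite sub0r normrN ger0_norm// exprn_ge0//.
Qed.

Lemma bernoulli (d : R) m : 0 <= d -> d <= 1 -> 1 - m%:R * d <= (1 - d) ^+ m.
Proof.
move=> d0 d1; elim: m => [|m IH]; first by rewrite mul0r subr0 expr0.
have p0 : 0 <= (1 - d) ^+ m by rewrite exprn_ge0// subr_ge0.
have p1 : (1 - d) ^+ m <= 1 by rewrite exprn_ile1// ?subr_ge0// lerBlDr lerDl.
rewrite exprSr -natr1; nra.
Qed.

Lemma geometric_cvg (H : completeNormedModType R[i]) (u : nat -> H) (c q : R) :
  0 <= q -> q < 1 -> (forall n, rnorm (u n.+1 - u n) <= c * q ^+ n) ->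
  exists l, seq_cvg u l /\ (forall n, rnorm (u n - l) <= c * q ^+ n / (1 - q)).
Proof.
move=> q0 q1 uq.
have q1' : 0 < 1 - q by rewrite subr_gt0.
have c0 : 0 <= c.
  by have := uq 0%N; rewrite expr0 mulr1; apply: le_trans; apply: rnorm_ge0.
have qn n : 0 <= q ^+ n by rewrite exprn_ge0.
have dist m k :
    rnorm (u (m + k)%N - u m) <= c * (q ^+ m - q ^+ (m + k)) / (1 - q).
  elim: k => [|k IH]; first by rewrite addn0 !subrr rnorm0 mulr0 mul0r.
  rewrite addnS (le_trans (rnorm_dist _ (u (m + k)%N) _))//.
  rewrite (le_trans (lerD (uq _) IH))// ler_pdivlMr// mulrDl mulfVK ?gt_eqF//.
  by rewrite exprSr; lra.
have dist' m n : (m <= n)%N -> rnorm (u n - u m) <= c * q ^+ m / (1 - q).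
  move=> /subnKC <-; apply: le_trans (dist _ _) _.
  rewrite ler_pM2r ?invr_gt0// ler_wpM2l// gerBl//.
have [l ul] : exists l, seq_cvg u l.
  apply/seq_cauchy_cvg/seq_cauchy_sqr => e e0.
  have sc : 0 < c / (1 - q) + 1 by rewrite ltr_wpDl// divr_ge0// ltW.
  have [|N hN] := @exprn_small q (Num.min e 1 / (c / (1 - q) + 1)) q0 q1.
    by rewrite divr_gt0// lt_min e0 ltr01.
  exists N => m n Nm mn.
  have h1 : rnorm (u n - u m) < Num.min e 1.
    apply: le_lt_trans (dist' _ _ mn) _.
    have := hN _ Nm; rewrite ltr_pdivlMr//; apply: le_lt_trans.
    by rewrite mulrDr mulr1 mulrAC mulrC lerDl.
  move: h1; rewrite lt_min => /andP[h1 h2].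
  by have := rnorm_ge0 (u n - u m); nra.
exists l; split=> // m.
apply/ler_addgt0Pr => e /ul[N hN].
have /hN h : (N <= maxn N m)%N by rewrite leq_maxl.
apply: le_trans (rnorm_dist _ (u (maxn N m)) _) _.
by apply: lerD; [rewrite rnormB dist'// leq_maxr | rewrite ltW].
Qed.

End Geometric.

(** * Choice of phases *)

Section Phase.
Variables (R : realType) (H : completeNormedModType R[i]).
Variable inner : {dot H for Num.conj}.
Hypothesis inner_norm : induces_norm inner.

(** Averaging [|sum_k om^k y_k|^2] over all [om] with [om^N = lam] gives
    [sum_k |y_k|^2], so one of them does at least as well. For [N] a power of
    2 the averaging can be done one square root at a time, with the
    parallelogram law: fold the second half of the sum onto the first with
    the factor [om^(N/2) = t], where [t] is the better of the two square roots
    of [lam]. *)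
Lemma exists_phase_sum_ge n (lam : R[i]) (y : nat -> H) : rabs lam = 1 ->
  exists om, [/\ rabs om = 1, om ^+ (2 ^ n) = lam &
    \sum_(k < 2 ^ n) rnorm (y k) ^+ 2
      <= rnorm (\sum_(k < 2 ^ n) om ^+ k *: y k) ^+ 2].
Proof.
elim: n lam y => [|n IH] lam y lam1.
  exists lam; split; rewrite ?expr1//.
  by rewrite expn0 !big_ord1 expr0 scale1r.
pose N := (2 ^ n)%N; pose s := sqrtc lam.
have s1 : rabs s = 1.
  apply/eqP; rewrite -(@eqrXn2 _ 2%N) ?rabs_ge0 ?ler01//.
  by rewrite -rabsX sqr_sqrtc lam1 expr1n.
have NN : (2 ^ n.+1 = N + N)%N by rewrite expnS mul2n -addnn.
pose S t := \sum_(k < N) rnorm (y k + t *: y (N + k)%N) ^+ 2.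
have SS : S s + S (- s) = 2 * \sum_(k < N + N) rnorm (y k) ^+ 2.
  rewrite big_split_ord /= /S -!big_split /= mulr_sumr.
  apply: eq_bigr => k _.
  by rewrite scaleNr (parallelogram inner_norm) rnormZ s1 mul1r mulrDr.
have [t [t1 t2 St]] : exists t, [/\ rabs t = 1, t ^+ 2 = lam &
    \sum_(k < N + N) rnorm (y k) ^+ 2 <= S t].
  have [h|h] := lerP (\sum_(k < N + N) rnorm (y k) ^+ 2) (S s).
    by exists s; rewrite sqr_sqrtc.
  by exists (- s); rewrite rabsN sqrrN sqr_sqrtc; split=> //; lra.
have [om [om1 omN omS]] := IH t (fun k => y k + t *: y (N + k)%N) t1.
exists om; split=> //.
  by rewrite expnSr exprM omN.
rewrite NN; apply: le_trans St _; apply: le_trans omS _.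
rewrite le_eqVlt; apply/orP; left; apply/eqP; congr (rnorm _ ^+ 2).
rewrite big_split_ord /= -big_split /=; apply: eq_bigr => k _.
by rewrite scalerDr scalerA exprD omN (mulrC t).
Qed.

End Phase.

(** * Resolvents *)

Section Resolvent.
Variables (R : realType) (H : completeNormedModType R[i]).
Variable S : operator H.
Implicit Types (x v : H) (z : R[i]).

Lemma resolventP z : set_bij (dom S) setT (op_shift S z) ->
  (forall x, dom S (resolvent S z x) /\
     S (resolvent S z x) - z *: resolvent S z x = x) /\
  (forall v, dom S v -> resolvent S z (S v - z *: v) = v).
Proof.
move=> bij; have [_ inj surj] := bij.
split=> [x|v Dv].
  split; first by have [+ _ _] := bijpinv_bij (fun=> 0) bij; apply.
  by have := surjpK (fun=> 0) surj; apply; rewrite in_setT.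
have := pinvKV (fun=> 0) inj; apply.
by rewrite inE.
Qed.

Lemma resolvent_set_lower_bound z : resolvent_set S z ->
  exists M : R, forall v, dom S v -> rnorm v <= M * rnorm (S v - z *: v).
Proof.
move=> [/resolventP[_ RS] [M RM]]; exists M => v Dv.
by rewrite -[X in rnorm X <= _]RS.
Qed.

End Resolvent.

(** * Approximate eigenvalues of a normal operator *)

Section NormalSpectrum.
Variables (R : realType) (H : completeNormedModType R[i]).
Variable inner : {dot H for Num.conj}.
Hypothesis inner_norm : induces_norm inner.
Variable T : operator H.
Hypothesis T_normal : op_normal inner T.
Implicit Types (x y v w : H) (z : R[i]).
Local Notation rip := (re_inner inner).

Let T_linear : op_linear T. Proof. by case: T_normal. Qed.

(** If [T - z] shrinks some vector by the factor [s], then within distance [s]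
    of [z] there are approximate eigenvalues of any prescribed quality. With
    [c] the norm of the resolvent they are found on the circle of radius
    [1 / c <= s] around [z]. *)
Lemma approx_eigenvalue_on_circle z v (s d : R) : resolvent_set T z ->
  dom T v -> v != 0 -> rnorm (T v - z *: v) <= s * rnorm v -> 0 < d ->
  exists z' v', [/\ rabs (z' - z) <= s, dom T v', v' != 0 &
    rnorm (T v' - z' *: v') <= d * rnorm v'].
Proof.
move=> [bij [M RM]] Dv v0 vs d0; have [RP RK] := resolventP bij.
set B := resolvent T z in RP RK RM.
have DB x : dom T (B x) by case: (RP x).
have TB x : T (B x) - z *: B x = x by case: (RP x).
have B_neq0 x : x != 0 -> B x != 0.
  apply: contra_neq => Bx0; rewrite -(TB x) Bx0 (op0 T_linear).
  by rewrite scaler0 subr0.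
pose E := [set c : R | exists2 x : H, x != 0 & c = rnorm (B x) / rnorm x].
have f0 : T v - z *: v != 0.
  apply: contra_neq v0 => Tv0; rewrite -(RK _ Dv) Tv0.
  apply/eqP; rewrite -rnorm_eq0 eq_le rnorm_ge0 andbT.
  by rewrite (le_trans (RM _))// rnorm0 mulr0.
have supE : has_sup E.
  split.
    by exists (rnorm (B (T v - z *: v)) / rnorm (T v - z *: v)), (T v - z *: v).
  exists M => _ [x x0 ->]; rewrite ler_pdivrMr ?rnorm_gt0//.
(* The operator norm of the resolvent. *)
pose c := sup E.
have Bc x : rnorm (B x) <= c * rnorm x.
  have [->|x0] := eqVneq x 0.
    by have := RM 0; rewrite rnorm0 !mulr0.
  rewrite -ler_pdivrMr ?rnorm_gt0//.
  by apply: ub_le_sup; [case: supE|exists x].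
have cs : 1 <= c * s.
  have := Bc (T v - z *: v); rewrite RK// => h.
  have v_gt0 : 0 < rnorm v by rewrite rnorm_gt0.
  have c0 : 0 <= c.
    apply: (@le_trans _ _ (rnorm (B (T v - z *: v)) / rnorm (T v - z *: v))).
      by rewrite divr_ge0 ?rnorm_ge0.
    by apply: ub_le_sup; [case: supE|exists (T v - z *: v)].
  rewrite -(ler_pM2r v_gt0) mul1r -mulrA; apply: le_trans h _.
  exact: ler_wpM2l.
have s_ge0 : 0 <= s.
  rewrite -(pmulr_lge0 s (_ : 0 < rnorm v)) ?rnorm_gt0//.
  by rewrite (le_trans _ vs) ?rnorm_ge0.
have c_gt0 : 0 < c.
  have : 0 < c * s by exact: lt_le_trans cs.
  rewrite pmulr_lgt0// lt_def s_ge0 andbT.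
  by apply: contraTneq cs => ->; rewrite mulr0 ler10.
(* The number [2 ^ n] of terms is such that the final ratio
   [2 |x| / (c sqrt (2 ^ n / 2) |x|)] is at most [d]. *)
have [n hn] : exists n, 8 <= d ^+ 2 * c ^+ 2 * (2 ^ n)%:R.
  have dc : 0 < d ^+ 2 * c ^+ 2 by rewrite mulr_gt0 ?exprn_gt0.
  have dc8 : 0 < d ^+ 2 * c ^+ 2 / 8 by rewrite divr_gt0.
  have [m hm] := invS_lt dc8.
  exists m; have := hm m (leqnn m).
  rewrite ltr_pdivlMr// mulrC ltr_pdivrMr ?ltr0n// => /ltW h.
  apply: le_trans h _; apply: ler_wpM2l; first exact: ltW.
  by rewrite ler_nat; apply: ltn_expl.
set N := (2 ^ n)%N in hn.
have N_gt0 : (0 < N)%N by rewrite expn_gt0.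
have NR : 0 < N%:R :> R by rewrite ltr0n.
(* The vector [x] attains the norm up to the factor [1 - e]; losing this
   factor at each of [N] steps, and squaring, costs at most a factor 2. *)
pose e : R := (4 * N%:R)^-1.
have e_gt0 : 0 < e by rewrite invr_gt0 mulr_gt0.
have e_le1 : e <= 1.
  by rewrite invf_le1 ?mulr_gt0// (@le_trans _ _ 4) ?ler1n// ler_peMr// ler1n.
pose t := 1 - e.
have t_ge0 : 0 <= t by rewrite subr_ge0.
have t_le1 : t <= 1 by rewrite gerBl ltW.
have [x x0 xt] : exists2 x, x != 0 & c * t * rnorm x <= rnorm (B x).
  have : c * e > 0 by rewrite mulr_gt0.
  move=> /sup_adherent/(_ supE)[_ [x x0 ->] h]; exists x => //.
  rewrite -ler_pdivlMr ?rnorm_gt0// ltW//; apply: le_lt_trans h.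
  by rewrite /t mulrBr mulr1.
pose y k := iter k B x.
have y0 k : y k != 0 by elim: k => //= k; apply: B_neq0.
have convex k : rnorm (y k.+1) ^+ 2 <= rnorm (y k.+2) * rnorm (y k).
  have := @normal_shift_log_convex _ _ _ inner_norm _ T_normal z (y k.+2).
  by rewrite /y !iterS !TB; apply.
have ratio k : c * t * rnorm (y k) <= rnorm (y k.+1).
  elim: k => [//|k IH].
  have yk : 0 < rnorm (y k) by rewrite rnorm_gt0.
  rewrite -(ler_pM2r yk); apply: le_trans (convex k).
  by rewrite mulrAC expr2; apply: ler_wpM2r => //; apply: rnorm_ge0.
have y_ge k : (c * t) ^+ k * rnorm x <= rnorm (y k).
  elim: k => [|k IH]; first by rewrite mul1r.
  apply: le_trans (ratio k); rewrite exprS -mulrA; apply: ler_wpM2l => //.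
  by rewrite mulr_ge0// ltW.
have y_le k : rnorm (y k) <= c ^+ k * rnorm x.
  elim: k => [|k IH]; first by rewrite mul1r.
  by apply: le_trans (Bc _) _; rewrite exprS -mulrA ler_wpM2l// ltW.
pose ic : R[i] := (c^-1)%:C.
have ric : rabs ic = c^-1 by rewrite rabsR ger0_norm// invr_ge0 ltW.
have rabs1 : rabs (1 : R[i]) = 1 by rewrite (rabsR 1) normr1.
have [om [om1 omN omS]] :=
  exists_phase_sum_ge inner_norm n (fun k => ic ^+ k *: y k.+1) rabs1.
rewrite -/N in omN omS.
pose a := om * ic.
have ra : rabs a = c^-1 by rewrite rabsM om1 mul1r.
pose F k := a ^+ k *: y k.+1.
pose q := \sum_(k < N) F k.
have DF k : dom T (F k) by apply: domZ => //; apply: DB.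
have Dq : dom T q by apply: dom_sum.
(* The terms telescope, since [T - z] maps [y k.+1] to [y k]. *)
have Tq : T q - (z + a) *: q = x - a ^+ N *: y N.
  rewrite scalerDl opprD addrA {1}/q (op_sum T_linear)// /q scaler_sumr -sumrB.
  transitivity (\sum_(k < N) (a ^+ k *: y k - a ^+ k.+1 *: y k.+1)).
    rewrite scaler_sumr -sumrB; apply: eq_bigr => k _.
    rewrite (opZ T_linear); last exact: DB.
    rewrite scalerA mulrC -scalerA -scalerBr TB /F.
    by rewrite (scalerA a) -exprS.
  elim: (N) => [|m IH]; first by rewrite big_ord0 expr0 scale1r subrr.
  by rewrite big_ord_recr /= IH subrKA.
have Tq_le : rnorm (T q - (z + a) *: q) <= 2 * rnorm x.
  rewrite Tq (le_trans (rnormD _ _))// rnormN rnormZ rabsX ra.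
  rewrite [2 * _]mulrDl mul1r lerD2l exprVn ler_pdivrMl ?exprn_gt0//.
have q_ge : c ^+ 2 * N%:R / 2 * rnorm x ^+ 2 <= rnorm q ^+ 2.
  have -> : q = \sum_(k < N) om ^+ k *: (ic ^+ k *: y k.+1).
    by apply: eq_bigr => k _; rewrite scalerA -exprMn.
  apply: le_trans omS.
  have -> : c ^+ 2 * N%:R / 2 * rnorm x ^+ 2 =
      \sum_(k < N) (c ^+ 2 / 2 * rnorm x ^+ 2).
    by rewrite sumr_const card_ord -mulr_natr; ring.
  apply: ler_sum => k _; rewrite rnormZ rabsX ric exprMn exprVn.
  have ck : 0 < (c ^+ k) ^+ 2 by rewrite !exprn_gt0.
  rewrite exprVn ler_pdivlMl//.
  have h : ((c * t) ^+ k.+1 * rnorm x) ^+ 2 <= rnorm (y k.+1) ^+ 2.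
    rewrite ler_pXn2r ?nnegrE ?rnorm_ge0//.
    by rewrite mulr_ge0 ?rnorm_ge0// exprn_ge0// mulr_ge0// ltW.
  apply: le_trans h.
  have -> : (c ^+ k) ^+ 2 * (c ^+ 2 / 2 * rnorm x ^+ 2) =
    c ^+ 2 * (c ^+ k) ^+ 2 * rnorm x ^+ 2 * 2^-1 by ring.
  have -> : ((c * t) ^+ k.+1 * rnorm x) ^+ 2 =
    c ^+ 2 * (c ^+ k) ^+ 2 * rnorm x ^+ 2 * (t ^+ k.+1) ^+ 2.
    by rewrite !exprMn (exprS c k) exprMn; ring.
  apply: ler_wpM2l.
    by apply: mulr_ge0; [apply: mulr_ge0|]; apply: sqr_ge0.
  rewrite -exprM.
  have : t ^+ (N * 2) <= t ^+ (k.+1 * 2).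
    by apply: ler_wiXn2l => //; rewrite leq_mul2r /= ltn_ord.
  apply: le_trans; apply: le_trans (bernoulli (N * 2) (ltW e_gt0) e_le1).
  suff -> : 1 - (N * 2)%:R * e = 2^-1 by [].
  by rewrite natrM /e; field; rewrite gt_eqF.
have rx : 0 < rnorm x by rewrite rnorm_gt0.
have rx2 : 0 < rnorm x ^+ 2 by rewrite exprn_gt0.
exists (z + a), q; split => //.
- by rewrite addrC addKr ra -[c^-1]mulr1 ler_pdivrMl.
- rewrite -rnorm_gt0 lt_def rnorm_ge0 andbT; apply: contraTneq q_ge => ->.
  rewrite expr0n /= -ltNge; apply: mulr_gt0 => //; apply: divr_gt0 => //.
  by rewrite mulr_gt0// exprn_gt0.
- have dq0 : 0 <= d * rnorm q.
    by apply: mulr_ge0; [exact: ltW|exact: rnorm_ge0].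
  rewrite -(@ler_pXn2r _ 2%N) ?nnegrE ?rnorm_ge0//.
  apply: (@le_trans _ _ ((2 * rnorm x) ^+ 2)).
    by rewrite ler_pXn2r ?nnegrE ?rnorm_ge0// mulr_ge0 ?rnorm_ge0.
  rewrite !exprMn.
  apply: (@le_trans _ _ (d ^+ 2 * (c ^+ 2 * N%:R / 2 * rnorm x ^+ 2)));
    last first.
    by rewrite ler_wpM2l ?sqr_ge0.
  by nra.
Qed.

End NormalSpectrum.

(** * The distance to the spectrum *)

Section ScalarLimit.
Variables (R : realType) (H : completeNormedModType R[i]).
Variable inner : {dot H for Num.conj}.
Hypothesis inner_norm : induces_norm inner.
Local Notation rip := (re_inner inner).

Lemma rip_scale_self z (v : H) : rip (z *: v) v = complex.Re z * rnorm v ^+ 2.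
Proof.
rewrite /re_inner linearZl_LR /= inner_norm norm_rnorm -rmorphXn.
by case: z => a b /=; ring.
Qed.

Lemma rip_scale_i z (v : H) :
  rip (z *: v) ('i *: v) = complex.Im z * rnorm v ^+ 2.
Proof.
rewrite /re_inner linearZl_LR linearZr_LR /= inner_norm norm_rnorm -rmorphXn.
by case: z => a b /=; ring.
Qed.

Lemma rabs_i : rabs ('i : R[i]) = 1.
Proof.
apply/eqP; rewrite -(@eqrXn2 _ 2%N) ?rabs_ge0 ?ler01// rabs_sqr /=.
by rewrite expr0n add0r.
Qed.

Lemma rabs_le (z : R[i]) : rabs z <= `|complex.Re z| + `|complex.Im z|.
Proof.
rewrite -(@ler_pXn2r _ 2%N) ?nnegrE ?rabs_ge0 ?addr_ge0//.
rewrite rabs_sqr sqrrD !real_normK ?num_real// -addrA lerD2l lerDr.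
by rewrite mulrn_wge0// mulr_ge0.
Qed.

(** Completeness of the complex line, read off from the completeness of [H] by
    letting the scalars act on a fixed vector. *)
Lemma scalar_geometric_cvg (v : H) (z : nat -> R[i]) (c : R) : v != 0 ->
  (forall n, rabs (z n.+1 - z n) <= c * 2^-1 ^+ n) ->
  exists w, forall n, rabs (z n - w) <= 4 * (c * 2^-1 ^+ n).
Proof.
move=> v0 zc; have rv : 0 < rnorm v by rewrite rnorm_gt0.
have h1 : (0 : R) <= 2^-1 by rewrite invr_ge0.
have h2 : (2^-1 : R) < 1 by rewrite invf_lt1 ?ltr1n.
have [n|l [_ ul]] :=
  @geometric_cvg R H (fun n => z n *: v) (c * rnorm v) _ h1 h2.
  by rewrite -scalerBl rnormZ mulrAC ler_pM2r.
exists ((rip l v / rnorm v ^+ 2) +i* (rip l ('i *: v) / rnorm v ^+ 2)) => n.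
set w := _ +i* _.
have lw1 : rip l v = complex.Re w * rnorm v ^+ 2.
  by rewrite /w /= mulfVK// gt_eqF// exprn_gt0.
have lw2 : rip l ('i *: v) = complex.Im w * rnorm v ^+ 2.
  by rewrite /w /= mulfVK// gt_eqF// exprn_gt0.
clearbody w.
have rv2 : 0 < rnorm v ^+ 2 by rewrite exprn_gt0.
have un : rnorm (z n *: v - l) <= 2 * (c * 2^-1 ^+ n) * rnorm v.
  apply: le_trans (ul n) _.
  by rewrite le_eqVlt; apply/orP; left; apply/eqP; field.
have ReB : complex.Re (z n - w) = complex.Re (z n) - complex.Re w.
  by rewrite ReD ReN.
have ImB : complex.Im (z n - w) = complex.Im (z n) - complex.Im w.
  by case: (z n) w {lw1 lw2 ReB} => [? ?] [].
have key (a : R) : `|a * rnorm v ^+ 2| <= rnorm (z n *: v - l) * rnorm v ->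
    `|a| <= 2 * (c * 2^-1 ^+ n).
  rewrite normrM (ger0_norm (ltW rv2)) (expr2 (rnorm v)) (mulrA `|a|).
  rewrite (ler_pM2r rv) => h.
  by rewrite -(ler_pM2r rv); apply: le_trans h un.
have re : `|complex.Re (z n - w)| <= 2 * (c * 2^-1 ^+ n).
  apply: key; rewrite ReB mulrBl -lw1 -rip_scale_self -ripBl.
  exact: rip_abs.
have im : `|complex.Im (z n - w)| <= 2 * (c * 2^-1 ^+ n).
  apply: key; rewrite ImB mulrBl -lw2 -rip_scale_i -ripBl.
  apply: le_trans (rip_abs inner_norm _ _) _.
  by rewrite rnormZ rabs_i mul1r.
by apply: le_trans (rabs_le _) _; lra.
Qed.

End ScalarLimit.

Section NormalBound.
Variables (R : realType) (H : completeNormedModType R[i]).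
Variable inner : {dot H for Num.conj}.
Hypothesis inner_norm : induces_norm inner.
Variable T : operator H.
Hypothesis T_normal : op_normal inner T.
Implicit Types (v w : H).
Local Notation rip := (re_inner inner).

Let T_linear : op_linear T. Proof. by case: T_normal. Qed.

(** For a normal operator the norm of the resolvent is the inverse distance to
    the spectrum. Otherwise [approx_eigenvalue_on_circle], applied repeatedly,
    yields points [z n] and vectors on which [T - z n] shrinks by [ep n]; the
    first point is at distance at most [s < r] from [z], the next ones move
    by [ep n], and the limit [w] is still in the disc although [T - w] is not
    bounded below. *)
Theorem normal_resolvent_ball z (r : R) :
  (forall z', rabs (z' - z) < r -> resolvent_set T z') ->
  forall v, dom T v -> r * rnorm v <= rnorm (T v - z *: v).
Proof.
move=> ball v Dv; rewrite leNgt; apply/negP => vr.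
have v0 : v != 0.
  apply: contraTneq vr => ->; rewrite (op0 T_linear) scaler0 subr0 rnorm0.
  by rewrite mulr0 ltxx.
have rv : 0 < rnorm v by rewrite rnorm_gt0.
pose s := rnorm (T v - z *: v) / rnorm v.
have s_ge0 : 0 <= s by rewrite divr_ge0 ?rnorm_ge0.
have sr : s < r by rewrite ltr_pdivrMr.
pose e := (r - s) / 3.
have e0 : 0 < e by rewrite divr_gt0// subr_gt0.
pose ep n : R := e * 2^-1 ^+ n.
have ep0 n : 0 < ep n by rewrite mulr_gt0// exprn_gt0.
have epS n : ep n = 2 * ep n.+1 by rewrite /ep exprS; field.
(* The margin [e] keeps the limit strictly inside the disc, and [2 * ep n] is
   the total length of the remaining moves. *)
pose P n (p : R[i] * H) := [/\ dom T p.2, p.2 != 0,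
  rnorm (T p.2 - p.1 *: p.2) <= ep n * rnorm p.2 &
  rabs (p.1 - z) <= r - e - 2 * ep n].
have Pr n p : P n p -> rabs (p.1 - z) < r.
  by case=> _ _ _ h; apply: le_lt_trans h _; have := ep0 n; lra.
have [p0 Pp0] : exists p, P 0%N p.
  have z_ball : resolvent_set T z.
    by apply: ball; rewrite subrr (rabsR 0) normr0; apply: le_lt_trans sr.
  have [|z' [v' [? ? ? ?]]] := approx_eigenvalue_on_circle inner_norm T_normal
    z_ball Dv v0 (s := s) _ (ep0 0%N).
    by rewrite mulfVK// gt_eqF.
  exists (z', v'); split=> //=.
  suff -> : r - e - 2 * ep 0%N = s by [].
  by rewrite /ep expr0 /e; field.
have /choice[f fP] (np : nat * (R[i] * H)) : exists p', P np.1 np.2 ->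
    P np.1.+1 p' /\ rabs (p'.1 - np.2.1) <= ep np.1.
  have [Pp|nP] := pselect (P np.1 np.2); last by exists np.2.
  have z_ball := ball _ (Pr _ _ Pp).
  case: Pp => Dp p_neq0 Tp pz.
  have [z' [v' [z'z ? ? ?]]] := approx_eigenvalue_on_circle inner_norm T_normal
    z_ball Dp p_neq0 Tp (ep0 np.1.+1).
  exists (z', v') => _; split=> //; split=> //=.
  rewrite -[z' - z](subrKA np.2.1); apply: le_trans (rabs_leD _ _) _.
  by have := epS np.1; lra.
pose p := fix p n := if n is m.+1 then f (m, p m) else p0.
have Pp n : P n (p n).
  by elim: n => [//|n IH] /=; have [] := fP (n, p n) IH.
have pS n : rabs ((p n.+1).1 - (p n).1) <= ep n.
  by have [] := fP (n, p n) (Pp n).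
have [w pw] := scalar_geometric_cvg inner_norm v0 pS.
have small (d : R) : 0 < d -> exists n, ep n < d.
  move=> d0; have h1 : (0 : R) <= 2^-1 by rewrite invr_ge0.
  have h2 : (2^-1 : R) < 1 by rewrite invf_lt1 ?ltr1n.
  have [N hN] := exprn_small h1 h2 (divr_gt0 d0 e0).
  by exists N; have := hN N (leqnn N); rewrite ltr_pdivlMr// mulrC.
have /resolvent_set_lower_bound[M wM] : resolvent_set T w.
  apply: ball; have [|n hn] := small (e / 4); first by rewrite divr_gt0.
  rewrite -[w - z](subrKA (p n).1); apply: le_lt_trans (rabs_leD _ _) _.
  rewrite -rabsN opprB; have [_ _ _] := Pp n; have := pw n; rewrite -/(ep n).
  by have := ep0 n; lra.
have M1 : 0 < `|M| + 1 by rewrite ltr_wpDl.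
have [|n] := small (5 * (`|M| + 1))^-1; first by rewrite invr_gt0 mulr_gt0.
rewrite -[ltRHS]mul1r ltr_pdivlMr ?mulr_gt0//; apply/negP; rewrite -leNgt.
have [Dn n0 Tn _] := Pp n.
have rn : 0 < rnorm (p n).2 by rewrite rnorm_gt0.
rewrite -(ler_pM2r rn) mul1r; apply: le_trans (wM _ Dn) _.
have h : rnorm (T (p n).2 - w *: (p n).2) <= 5 * ep n * rnorm (p n).2.
  rewrite -[X in rnorm X](subrKA ((p n).1 *: (p n).2)).
  apply: le_trans (rnormD _ _) _; rewrite -scalerBl rnormZ.
  have : rabs ((p n).1 - w) * rnorm (p n).2 <= 4 * ep n * rnorm (p n).2.
    by rewrite ler_pM2r//; exact: pw.
  by move: Tn; lra.
apply: (@le_trans _ _ ((`|M| + 1) * rnorm (T (p n).2 - w *: (p n).2))).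
  by rewrite ler_wpM2r ?rnorm_ge0// ler_wpDr// ler_norm.
apply: le_trans (ler_wpM2l (ltW M1) h) _.
by rewrite le_eqVlt; apply/orP; left; apply/eqP; ring.
Qed.

End NormalBound.

(** * Normal operators with spectrum in a strip *)

Section Strip.
Variables (R : realType) (H : completeNormedModType R[i]).
Variable inner : {dot H for Num.conj}.
Hypothesis inner_norm : induces_norm inner.
Variable T : operator H.
Hypothesis T_normal : op_normal inner T.
Variables gamma1 gamma2 : R.
Hypothesis T_spectrum :
  spectrum T `<=` [set z : R[i] | gamma1 <= complex.Im z <= gamma2].
Implicit Types (v w : H).
Local Notation rip := (re_inner inner).
Local Notation adjoint_at := (adjoint_at inner T).

Let T_linear : op_linear T. Proof. by case: T_normal. Qed.
Let T_dense : densely_defined T. Proof. by case: T_normal. Qed.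

Lemma outside_strip z :
  ~~ (gamma1 <= complex.Im z <= gamma2) -> resolvent_set T z.
Proof. by move=> /negP zs; apply: contrapT => /T_spectrum. Qed.

Lemma ImB_le_rabs (z z' : R[i]) :
  `|complex.Im z - complex.Im z'| <= rabs (z - z').
Proof.
rewrite -(@ler_pXn2r _ 2%N) ?nnegrE ?rabs_ge0// rabs_sqr real_normK ?num_real//.
by case: z z' => [? ?] [? ?] /=; rewrite lerDr sqr_ge0.
Qed.

(** Above the strip, the disc of radius [Im z - gamma2] around [z] avoids the
    spectrum. Below the height [gamma2] the left side is nonpositive. *)
Lemma above_strip z v : dom T v ->
  (complex.Im z - gamma2) * rnorm v <= rnorm (T v - z *: v).
Proof.
move=> Dv; apply: (normal_resolvent_ball inner_norm T_normal _ Dv) => z' zz'.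
apply: outside_strip; have := le_lt_trans (ImB_le_rabs z' z) zz'.
by rewrite ltr_norml negb_and -!ltNge => /andP[h _]; apply/orP; right; lra.
Qed.

Lemma below_strip z v : dom T v ->
  (gamma1 - complex.Im z) * rnorm v <= rnorm (T v - z *: v).
Proof.
move=> Dv; apply: (normal_resolvent_ball inner_norm T_normal _ Dv) => z' zz'.
apply: outside_strip; have := le_lt_trans (ImB_le_rabs z' z) zz'.
by rewrite ltr_norml negb_and -!ltNge => /andP[_ h]; apply/orP; left; lra.
Qed.

(** Extracts the first-order term in [y] of the disc bounds at [i y]. *)
Lemma linear_growth_le0 (k c g : R) : 0 <= c ->
  (forall y, g < y -> y * k <= c) -> k <= 0.
Proof.
move=> c0 h; rewrite leNgt; apply/negP => k0.
have := h (`|g| + 1 + c / k); rewrite mulrDl mulfVK ?gt_eqF// => /(_ _).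
have ck : 0 <= c / k by rewrite divr_ge0// ltW.
have g1 : g < `|g| + 1 + c / k by have := ler_norm g; lra.
move=> /(_ g1); apply/negP; rewrite -ltNge ltrDr mulr_gt0// ltr_wpDl//.
Qed.

Lemma rnorm_shift_sqr (y : R) v : rnorm (T v - y *i *: v) ^+ 2 =
  rnorm (T v) ^+ 2 - 2 * (y * rip (T v) ('i *: v)) + y ^+ 2 * rnorm v ^+ 2.
Proof.
have -> : y *i = y%:C * 'i.
  by rewrite /real_complex_def; congr Complex; ring.
rewrite -scalerA (rnormB2 inner_norm) ripZr !rnormZ rabsR rabs_i.
by rewrite mul1r exprMn real_normK ?num_real.
Qed.

(** The number [<T v, i v>] has real part [Im <T v, v>]. The square of the
    disc bound at [i y] is quadratic in [y] with the same leading term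
    [y^2 |v|^2] on both sides, so the coefficients of [y] compare as [y]
    grows. *)
Lemma Im_form_le v : dom T v -> rip (T v) ('i *: v) <= gamma2 * rnorm v ^+ 2.
Proof.
move=> Dv; rewrite -subr_le0.
apply: (@linear_growth_le0 _ (rnorm (T v) ^+ 2 / 2) gamma2).
  by rewrite divr_ge0 ?sqr_ge0.
move=> y gy.
have h1 : (y - gamma2) * rnorm v <= rnorm (T v - y *i *: v).
  exact: (@above_strip (y *i) v Dv).
have h0 : 0 <= (y - gamma2) * rnorm v.
  by apply: mulr_ge0; [rewrite subr_ge0 ltW|exact: rnorm_ge0].
have : ((y - gamma2) * rnorm v) ^+ 2 <= rnorm (T v - y *i *: v) ^+ 2.
  by rewrite ler_pXn2r ?nnegrE ?rnorm_ge0.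
rewrite exprMn (rnorm_shift_sqr y v); have : 0 <= gamma2 ^+ 2 * rnorm v ^+ 2.
  by rewrite -exprMn sqr_ge0.
by lra.
Qed.

Lemma Im_form_ge v : dom T v -> gamma1 * rnorm v ^+ 2 <= rip (T v) ('i *: v).
Proof.
move=> Dv; rewrite -subr_le0.
apply: (@linear_growth_le0 _ (rnorm (T v) ^+ 2 / 2) (- gamma1)).
  by rewrite divr_ge0 ?sqr_ge0.
move=> y gy.
have h1 : (gamma1 - - y) * rnorm v <= rnorm (T v - (- y) *i *: v).
  exact: (@below_strip ((- y) *i) v Dv).
have h0 : 0 <= (gamma1 - - y) * rnorm v.
  apply: mulr_ge0; last exact: rnorm_ge0.
  by rewrite subr_ge0 lerNl ltW.
have : ((gamma1 - - y) * rnorm v) ^+ 2 <= rnorm (T v - (- y) *i *: v) ^+ 2.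
  by rewrite ler_pXn2r ?nnegrE ?rnorm_ge0.
rewrite exprMn (rnorm_shift_sqr (- y) v).
have : 0 <= gamma1 ^+ 2 * rnorm v ^+ 2.
  by rewrite -exprMn sqr_ge0.
by lra.
Qed.

(** Allows testing an inequality on the image [(T - T^* ) v], which need not lie
    in the domain. *)
Lemma dense_rip_le (x : H) (c g : R) :
  (forall u, dom T u -> rip x u <= c + g * rnorm u ^+ 2) ->
  forall u, rip x u <= c + g * rnorm u ^+ 2.
Proof.
move=> h u.
have /choice[a aP] (n : nat) : exists a, dom T a /\ rnorm (u - a) < n.+1%:R^-1.
  have [|a Da ua] := @dense_approx _ _ _ u n.+1%:R^-1 T_dense.
    by rewrite invr_gt0.
  by exists a.
have au : seq_cvg a u.
  move=> e /invS_lt[N hN]; exists N => n /hN; apply: lt_trans.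
  by rewrite rnormB; case: (aP n).
have h1 : rip x (a n) @[n --> \oo] --> rip x u.
  rewrite ripC; under eq_fun do rewrite ripC.
  exact: seq_cvg_rip.
have h2 : c + g * rnorm (a n) ^+ 2 @[n --> \oo] --> c + g * rnorm u ^+ 2.
  apply: cvgD; first exact: cvg_cst.
  apply: cvgMr; under eq_fun do rewrite expr2.
  by rewrite expr2; apply: cvgM; apply: seq_cvg_rnorm.
by apply: ler_cvg_to h1 h2 _; apply: nearW => n; apply: h; case: (aP n).
Qed.

(** Polarisation of the quadratic form [Im <T v, v>]. *)
Lemma skew_part_form v w : dom T v -> adjoint_at v w -> forall u, dom T u ->
  rip (T v - w) ('i *: u) = rip (T v) ('i *: u) + rip (T u) ('i *: v).
Proof.
move=> Dv vw u Du; rewrite ripBl (ripC _ w) -vw; last exact: domZ.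
by rewrite (opZ T_linear)// ripil opprK.
Qed.

(** A symmetric form bounded by [g |v|^2] on the diagonal comes from an operator
    of norm at most [g]: bound the polarised form by the parallelogram law,
    then test it on a multiple of the image vector. Here the operator is
    [(T - T^* ) / 2i]. *)
Lemma skew_part_le v w (g : R) : 0 < g -> - g <= gamma1 -> gamma2 <= g ->
  dom T v -> adjoint_at v w -> rnorm (T v - w) <= 2 * g * rnorm v.
Proof.
move=> g0 g1 g2 Dv vw.
have bound u : dom T u ->
    rip (T v - w) ('i *: u) <= g * rnorm v ^+ 2 + g * rnorm u ^+ 2.
  move=> Du; rewrite (skew_part_form Dv vw Du).
  have := Im_form_le (domD T_linear Dv Du).
  have := Im_form_ge (domB T_linear Dv Du).
  rewrite (opB T_linear)// (opD T_linear)// !(scalerDr, scalerN).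
  rewrite !(ripDl, ripNl, ripDr, ripNr) => h1 h2.
  have := parallelogram inner_norm v u.
  have h3 : gamma2 * rnorm (v + u) ^+ 2 <= g * rnorm (v + u) ^+ 2.
    by rewrite ler_wpM2r ?sqr_ge0.
  have h4 : - g * rnorm (v - u) ^+ 2 <= gamma1 * rnorm (v - u) ^+ 2.
    by rewrite ler_wpM2r ?sqr_ge0.
  move: h1 h2 h3 h4.
  move: (rnorm (v + u) ^+ 2) (rnorm (v - u) ^+ 2) => p m h1 h2 h3 h4 par.
  have : g * (p + m) = g * (2 * rnorm v ^+ 2 + 2 * rnorm u ^+ 2) by rewrite par.
  lra.
set X := T v - w in bound *.
have bound' u : rip X u <= g * rnorm v ^+ 2 + g * rnorm u ^+ 2.
  apply: dense_rip_le u => u Du.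
  have := bound _ (domZ T_linear (- 'i) Du).
  rewrite scalerA mulrN -expr2 sqr_i opprK scale1r rnormZ rabsN rabs_i mul1r.
  exact.
(* The factor [1 / 2g] optimises the bound. *)
have := bound' ((2 * g)^-1%:C *: X).
rewrite ripZr (ripxx inner_norm) rnormZ rabsR ger0_norm; last first.
  by rewrite invr_ge0 mulr_ge0// ltW.
have gv : 0 <= 2 * g * rnorm v.
  by apply: mulr_ge0; [apply: mulr_ge0 => //; exact: ltW|exact: rnorm_ge0].
move=> h; rewrite -(@ler_pXn2r _ 2%N) ?nnegrE ?rnorm_ge0//.
move: h; rewrite !exprMn => h.
have -> : rnorm X ^+ 2 =
  4 * g * ((2 * g)^-1 * rnorm X ^+ 2 - g * ((2 * g)^-1 ^+ 2 * rnorm X ^+ 2)).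
  by field; rewrite gt_eqF.
have -> : 2 ^+ 2 * g ^+ 2 * rnorm v ^+ 2 = 4 * g * (g * rnorm v ^+ 2) by ring.
by rewrite ler_pM2l ?mulr_gt0//; lra.
Qed.

(** Write [S1] and [S2] for the real and imaginary parts of [T], and [x + i y]
    for [z]. Then [|T v|^2 = |S1 v|^2 + |S2 v|^2] and
    [|(T - z) v|^2 = |(S1 - x) v|^2 + |(S2 - y) v|^2]. The second component of
    the latter is at least [d |v|], which bounds [|v|] and
    [|S2 v| <= g |v|]. For [S1], Cauchy-Schwarz in the plane gives
    [d^2 (|(S1 - x) v| + |x| |v|)^2 <=
    (d^2 + x^2) (|(S1 - x) v|^2 + d^2 |v|^2)]. *)
Lemma relative_bound_resolvent z v (a b d g : R) :
  0 < d -> d <= complex.Im z - gamma2 \/ d <= gamma1 - complex.Im z ->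
  0 < g -> - g <= gamma1 -> gamma2 <= g -> dom T v ->
  d ^+ 2 * (a ^+ 2 * rnorm v ^+ 2 + b ^+ 2 * rnorm (T v) ^+ 2) <=
  (b ^+ 2 * (d ^+ 2 + complex.Re z ^+ 2) + a ^+ 2 + b ^+ 2 * g ^+ 2)
    * rnorm (T v - z *: v) ^+ 2.
Proof.
move=> d0 dz g0 g1 g2 Dv.
have [w vw wz] := normal_shift_adjoint inner_norm T_normal Dv.
(* [P + P'] is [2 (S1 - x) v] and [P - P'] is [2 i (S2 - y) v]. *)
set P := T v - z *: v; set P' := w - z^*%C *: v.
have PP' : rnorm P' = rnorm P by exact: wz.
have Tw : rnorm w = rnorm (T v) by have := wz 0; rewrite conjc0 !scale0r !subr0.
have par1 := parallelogram inner_norm P P'.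
have par2 := parallelogram inner_norm (T v) w.
rewrite PP' in par1; rewrite Tw in par2.
have im := skew_part_le g0 g1 g2 Dv vw.
set V := rnorm v in im *; have V0 : 0 <= V by exact: rnorm_ge0.
have p2 : 2 * d * V <= rnorm (P - P').
  have [->|V_neq0] := eqVneq V 0; first by rewrite mulr0 rnorm_ge0.
  have V_gt0 : 0 < V by rewrite lt_def V_neq0.
  rewrite -(ler_pM2r V_gt0).
  have := rip_abs inner_norm (P - P') ('i *: v).
  rewrite rnormZ rabs_i mul1r; apply: le_trans.
  have -> : rip (P - P') ('i *: v) =
      2 * (rip (T v) ('i *: v) - complex.Im z * V ^+ 2).
    have -> : P - P' = (T v - w) - z *: v + z^*%C *: v.
      rewrite /P /P' opprB addrACA [RHS]addrAC -!addrA; congr (_ + _).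
      by rewrite addrC -addrA addrC -addrA.
    rewrite ripDl ripBl (skew_part_form Dv vw Dv) !(rip_scale_i inner_norm).
    by rewrite -/V; case: (z) => ? ? /=; ring.
  have := Im_form_le Dv; have := Im_form_ge Dv; rewrite -/V => h1 h2.
  rewrite ler_normr; case: dz => dz; apply/orP.
    right; have := ler_wpM2r (sqr_ge0 V) dz; lra.
  left; have := ler_wpM2r (sqr_ge0 V) dz; lra.
have a1 : rnorm (T v + w) <= rnorm (P + P') + 2 * `|complex.Re z| * V.
  have -> : T v + w = (P + P') + (2 * complex.Re z)%:C *: v.
    have -> : (2 * complex.Re z)%:C = z + z^*%C.
      by case: (z) => x y; rewrite /real_complex_def /=; congr Complex; ring.
    by rewrite scalerDl /P /P' [in RHS]addrACA subrK subrK.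
  apply: le_trans (rnormD _ _) _; rewrite lerD2l rnormZ rabsR normrM.
  by rewrite (ger0_norm (_ : 0 <= 2)).
have x2 : complex.Re z ^+ 2 = `|complex.Re z| ^+ 2.
  by rewrite real_normK ?num_real.
rewrite x2; set x := `|_| in a1 *; have x0 : 0 <= x by exact: normr_ge0.
have A0 := rnorm_ge0 (T v + w); have B0 := rnorm_ge0 (T v - w).
have p10 := rnorm_ge0 (P + P'); have p20 := rnorm_ge0 (P - P').
move: (rnorm (T v + w)) (rnorm (T v - w)) (rnorm (P + P')) (rnorm (P - P'))
  A0 B0 p10 p20 im p2 a1 par1 par2 => A B p q A0 B0 p0 q0 im p2 a1 par1 par2.
have -> : rnorm (T v) ^+ 2 = (A ^+ 2 + B ^+ 2) / 4 by lra.
have -> : rnorm P ^+ 2 = (p ^+ 2 + q ^+ 2) / 4 by lra.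
have hq : 4 * (d ^+ 2 * V ^+ 2) <= q ^+ 2.
  have -> : 4 * (d ^+ 2 * V ^+ 2) = (2 * d * V) ^+ 2 by ring.
  by rewrite ler_pXn2r ?nnegrE// !mulr_ge0// ltW.
have hB : B ^+ 2 <= 4 * g ^+ 2 * V ^+ 2.
  have -> : 4 * g ^+ 2 * V ^+ 2 = (2 * g * V) ^+ 2 by ring.
  by rewrite ler_pXn2r ?nnegrE// !mulr_ge0// ltW.
have hA : d ^+ 2 * A ^+ 2 <= (d ^+ 2 + x ^+ 2) * (p ^+ 2 + q ^+ 2).
  apply: (@le_trans _ _ (d ^+ 2 * (p + 2 * x * V) ^+ 2)).
    by rewrite ler_wpM2l ?sqr_ge0// ler_pXn2r ?nnegrE// addr_ge0// !mulr_ge0.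
  apply: (@le_trans _ _ ((d ^+ 2 + x ^+ 2) * (p ^+ 2 + 4 * (d ^+ 2 * V ^+ 2)))).
    rewrite -subr_ge0.
    have -> : (d ^+ 2 + x ^+ 2) * (p ^+ 2 + 4 * (d ^+ 2 * V ^+ 2))
      - d ^+ 2 * (p + 2 * x * V) ^+ 2 = (x * p - 2 * d ^+ 2 * V) ^+ 2 by ring.
    exact: sqr_ge0.
  by rewrite ler_wpM2l ?addr_ge0 ?sqr_ge0// lerD2l.
have hV : 4 * (d ^+ 2 * V ^+ 2) <= p ^+ 2 + q ^+ 2.
  by apply: le_trans hq _; rewrite lerDr sqr_ge0.
have hB' : d ^+ 2 * B ^+ 2 <= g ^+ 2 * (p ^+ 2 + q ^+ 2).
  apply: (@le_trans _ _ (g ^+ 2 * (4 * (d ^+ 2 * V ^+ 2)))).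
    have -> : g ^+ 2 * (4 * (d ^+ 2 * V ^+ 2)) =
      d ^+ 2 * (4 * g ^+ 2 * V ^+ 2) by ring.
    by rewrite ler_wpM2l ?sqr_ge0.
  by rewrite ler_wpM2l ?sqr_ge0.
have a20 := sqr_ge0 a; have b20 := sqr_ge0 b.
have := ler_wpM2l a20 hV; have := ler_wpM2l b20 hA; have := ler_wpM2l b20 hB'.
lra.
Qed.

End Strip.

(** * Small perturbations of an operator bounded below *)

Lemma subrACA (V : zmodType) (p q r s : V) :
  (p - q) - (r - s) = (p - r) - (q - s).
Proof. by rewrite !opprB [s - r]addrC [s - q]addrC addrACA. Qed.

Section Perturbation.
Variables (R : realType) (H : completeNormedModType R[i]).
Variables T A : operator H.
Hypothesis T_linear : op_linear T.
Hypothesis A_linear : op_linear A.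
Hypothesis dom_TA : dom T `<=` dom A.
Variables (z : R[i]) (q d : R).
Hypothesis q_ge0 : 0 <= q.
Hypothesis q_lt1 : q < 1.
Hypothesis d_gt0 : 0 < d.
Hypothesis A_small :
  forall v, dom T v -> rnorm (A v) <= q * rnorm (T v - z *: v).
Hypothesis T_lower : forall v, dom T v -> d * rnorm v <= rnorm (T v - z *: v).

Lemma perturb_lower v : dom T v ->
  (1 - q) * d * rnorm v <= rnorm (op_shift (perturb T A) z v).
Proof.
move=> Dv; rewrite /op_shift /= addrAC.
rewrite -mulrA; apply: (@le_trans _ _ ((1 - q) * rnorm (T v - z *: v))).
  by rewrite ler_wpM2l ?T_lower// subr_ge0 ltW.
have := A_small Dv; have := ler_rnormB (T v - z *: v) (- A v).
by rewrite rnormN opprK; lra.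
Qed.

(** Solving [(T + A - z) v = y] for [x = (T - z) v] gives the fixed point
    equation [x = y - A (T - z)^-1 x] of a contraction of ratio [q]. *)
Lemma perturb_surj : resolvent_set T z ->
  forall y, exists2 v, dom T v & op_shift (perturb T A) z v = y.
Proof.
move=> [bij _] y; have [RP _] := resolventP bij.
pose B := resolvent T z; pose K x := A (B x).
have DB x : dom T (B x) by case: (RP x).
have TB x : T (B x) - z *: B x = x by case: (RP x).
have K_contr x x' : rnorm (K x - K x') <= q * rnorm (x - x').
  rewrite /K -(opB A_linear); try exact: dom_TA.
  apply: le_trans (A_small (domB T_linear (DB x) (DB x'))) _.
  by rewrite (opB T_linear)// scalerBr subrACA !TB.
pose x n := iter n (fun x => y - K x) 0.
have xd n : rnorm (x n.+1 - x n) <= rnorm (x 1%N - x 0%N) * q ^+ n.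
  elim: n => [|n IH]; first by rewrite expr0 mulr1.
  have -> : x n.+2 - x n.+1 = K (x n) - K (x n.+1).
    by rewrite /x !iterS opprB addrC subrKA.
  by rewrite (le_trans (K_contr _ _))// rnormB exprS mulrCA ler_wpM2l.
have [l [xl _]] := geometric_cvg q_ge0 q_lt1 xd.
have lK : y - K l = l.
  apply/eqP; rewrite -subr_eq0 -rnorm_eq0 eq_le rnorm_ge0 andbT.
  apply/ler_addgt0Pr => e e0; rewrite add0r.
  have [|N hN] := xl (e / 2); first by rewrite divr_gt0.
  apply: le_trans (rnorm_dist _ (x N.+1) _) _.
  have -> : y - K l - x N.+1 = K (x N) - K l.
    by rewrite /x iterS opprB addrC subrKA.
  have h1 := hN N.+1 (leqnSn N); have h2 := hN N (leqnn N).
  have := K_contr (x N) l; have := rnorm_ge0 (x N - l).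
  have := ler_wpM2r (rnorm_ge0 (x N - l)) (ltW q_lt1).
  by lra.
exists (B l) => //.
by rewrite /op_shift /= addrAC TB -/(K l) -[X in X + _]lK subrK.
Qed.

Lemma perturb_resolvent : resolvent_set T z ->
  resolvent_set (perturb T A) z /\
  (opnorm (resolvent (perturb T A) z) <= (1 / ((1 - q) * d))%:E)%E.
Proof.
move=> Tz; have k0 : 0 < (1 - q) * d by rewrite mulr_gt0// subr_gt0.
have bij : set_bij (dom (perturb T A)) setT (op_shift (perturb T A) z).
  split => //.
    move=> v v'; rewrite !inE => Dv Dv' vv'; apply/eqP.
    rewrite -subr_eq0 -rnorm_eq0 eq_le rnorm_ge0 andbT -(pmulr_rle0 _ k0).
    have Dd := domB T_linear Dv Dv'.
    apply: le_trans (perturb_lower Dd) _.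
    suff -> : op_shift (perturb T A) z (v - v') =
        op_shift (perturb T A) z v - op_shift (perturb T A) z v'.
      by rewrite vv' subrr rnorm0.
    rewrite /op_shift /= (opB T_linear)// (opB A_linear); try exact: dom_TA.
    by rewrite scalerBr addrACA -opprD subrACA.
  by move=> y _; have [v Dv <-] := perturb_surj Tz y; exists v.
have [RP _] := resolventP bij.
have bound y :
    rnorm (resolvent (perturb T A) z y) <= 1 / ((1 - q) * d) * rnorm y.
  have [Dr Er] := RP y; rewrite mulrAC mul1r ler_pdivlMr// mulrC.
  by apply: le_trans (perturb_lower Dr) _; rewrite -[X in _ <= rnorm X]Er.
split; first by split=> //; exists (1 / ((1 - q) * d)).
apply: ge_ereal_sup => _ [y /= y1 <-]; rewrite lee_fin.
apply: le_trans (bound y) _; rewrite -[leRHS]mulr1 ler_wpM2l//.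
by rewrite divr_ge0// ltW.
Qed.

End Perturbation.

(** * Perturbation of a normal operator with spectrum in a strip *)

Theorem proposition3p2 (R : realType) (H : completeNormedModType R[i])
    (inner : {dot H for Num.conj}) (inner_norm : induces_norm inner)
    (T A : operator H) (T_normal : op_normal inner T) (A_linear : op_linear A)
    (dom_TA : dom T `<=` dom A)
    (a b : R) (a_ge0 : 0 <= a) (b_ge0 : 0 <= b) (b_lt1 : b < 1)
    (A_bound : forall x, dom T x ->
       rnorm (A x) ^+ 2 <= a ^+ 2 * rnorm x ^+ 2 + b ^+ 2 * rnorm (T x) ^+ 2)
    (gamma1 gamma2 : R) (gamma12 : gamma1 < gamma2)
    (T_spectrum : spectrum T `<=`
       [set z : R[i] | gamma1 <= complex.Im z <= gamma2]) :
  let gammat := Num.max `|gamma1| `|gamma2| in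
  let lhs : set R[i] :=
    [set gamma1 *i - w | w in Hyp a b gammat] `|`
    [set gamma2 *i + w | w in Hyp a b gammat] in
  lhs `<=` resolvent_set (perturb T A) /\
  (forall z : R[i], lhs z ->
     let gamma := if complex.Im z < gamma1 then gamma1 else gamma2 in
     (opnorm (resolvent (perturb T A) z) <=
      (1 / (`|complex.Im z - gamma|
            - Num.sqrt (b ^+ 2 * (`|complex.Im z - gamma| ^+ 2
                                  + complex.Re z ^+ 2)
                        + a ^+ 2 + b ^+ 2 * gammat ^+ 2)))%:E)%E).
Proof.
move=> gammat lhs.
have T_linear : op_linear T by case: T_normal.
have G0 : 0 < gammat.
  rewrite lt_max !normr_gt0 -negb_and; apply: contraTN gamma12.
  by move=> /andP[/eqP-> /eqP->]; rewrite ltxx.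
have G1 : - gammat <= gamma1.
  by rewrite lerNl le_max -[`|gamma1|]normrN ler_norm.
have G2 : gamma2 <= gammat by rewrite le_max ler_norm orbT.
have b2 : 0 < 1 - b ^+ 2 by rewrite subr_gt0 expr_lt1.
(* The region [Hyp] is where the constant [q] below is less than 1. *)
have hyp_ineq (x y : R) :
    (a ^+ 2 + b ^+ 2 * gammat ^+ 2) / (1 - b ^+ 2)
      + b ^+ 2 * x ^+ 2 / (1 - b ^+ 2) < y ^+ 2 ->
    b ^+ 2 * (y ^+ 2 + x ^+ 2) + a ^+ 2 + b ^+ 2 * gammat ^+ 2 < y ^+ 2.
  by rewrite -mulrDl ltr_pdivrMr//; lra.
have lhsP z : lhs z ->
  let gamma := if complex.Im z < gamma1 then gamma1 else gamma2 in
  let d := `|complex.Im z - gamma| in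
  [/\ 0 < d, d <= complex.Im z - gamma2 \/ d <= gamma1 - complex.Im z,
    ~~ (gamma1 <= complex.Im z <= gamma2) &
    b ^+ 2 * (d ^+ 2 + complex.Re z ^+ 2) + a ^+ 2 + b ^+ 2 * gammat ^+ 2
      < d ^+ 2].
  case=> -[[x y] [/= h y0] <-].
    have -> : complex.Im (gamma1 *i - x +i* y) = gamma1 - y by [].
    have -> : complex.Re (gamma1 *i - x +i* y) = - x by rewrite /= add0r.
    have yE : `|gamma1 - y - gamma1| = y.
      by rewrite addrAC subrr add0r normrN gtr0_norm.
    rewrite /= gtrBl y0 yE sqrrN; split=> //.
    - by right; lra.
    - by rewrite negb_and -!ltNge; apply/orP; left; lra.
    - exact: hyp_ineq.
  have -> : complex.Im (gamma2 *i + x +i* y) = gamma2 + y by [].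
  have -> : complex.Re (gamma2 *i + x +i* y) = x by rewrite /= add0r.
  have yE : `|gamma2 + y - gamma2| = y by rewrite addrAC subrr add0r gtr0_norm.
  have -> /= : (gamma2 + y < gamma1) = false.
    by apply/negbTE; rewrite -leNgt; lra.
  rewrite yE; split=> //.
  - by left; lra.
  - by rewrite negb_and -!ltNge; apply/orP; right; lra.
  - exact: hyp_ineq.
suff main z : lhs z ->
  let gamma := if complex.Im z < gamma1 then gamma1 else gamma2 in
  resolvent_set (perturb T A) z /\
  (opnorm (resolvent (perturb T A) z) <=
      (1 / (`|complex.Im z - gamma|
            - Num.sqrt (b ^+ 2 * (`|complex.Im z - gamma| ^+ 2
                                  + complex.Re z ^+ 2)
                        + a ^+ 2 + b ^+ 2 * gammat ^+ 2)))%:E)%E.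
  by split=> z /main[].
move=> lz gamma; have := lhsP z lz; rewrite /= -/gamma.
set d := `|_|; set Q := _ + b ^+ 2 * gammat ^+ 2 => -[d0 dz zs Qd].
have Q0 : 0 <= Q.
  apply: addr_ge0; last by rewrite -exprMn sqr_ge0.
  apply: addr_ge0; last exact: sqr_ge0.
  by apply: mulr_ge0; [|apply: addr_ge0]; exact: sqr_ge0.
have Tz : resolvent_set T z := outside_strip T_spectrum zs.
have T_lower v : dom T v -> d * rnorm v <= rnorm (T v - z *: v).
  move=> Dv; case: dz => dz.
    apply: le_trans (above_strip inner_norm T_normal T_spectrum z Dv).
    by rewrite ler_wpM2r ?rnorm_ge0.
  apply: le_trans (below_strip inner_norm T_normal T_spectrum z Dv).
  by rewrite ler_wpM2r ?rnorm_ge0.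
pose q := Num.sqrt Q / d.
have q0 : 0 <= q by rewrite divr_ge0 ?sqrtr_ge0// ltW.
have q1 : q < 1.
  rewrite ltr_pdivrMr// mul1r.
  rewrite -(@ltr_pXn2r _ 2%N) ?nnegrE ?sqrtr_ge0 ?(ltW d0)//.
  by rewrite sqr_sqrtr.
have A_small v : dom T v -> rnorm (A v) <= q * rnorm (T v - z *: v).
  move=> Dv.
  have rhs0 : 0 <= q * rnorm (T v - z *: v) by rewrite mulr_ge0 ?rnorm_ge0.
  rewrite -(@ler_pXn2r _ 2%N) ?nnegrE ?rnorm_ge0//.
  apply: le_trans (A_bound v Dv) _.
  have d2 : 0 < d ^+ 2 by rewrite exprn_gt0.
  rewrite -(ler_pM2l d2) exprMn expr_div_n sqr_sqrtr//.
  rewrite (mulrA _ (Q / _)) (mulrC _ (Q / _)) divfK ?gt_eqF//.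
  exact: (relative_bound_resolvent inner_norm T_normal T_spectrum).
have -> : d - Num.sqrt Q = (1 - q) * d.
  by rewrite /q; field; rewrite gt_eqF.
exact: (perturb_resolvent T_linear A_linear dom_TA q0 q1 d0 A_small T_lower Tz).
Qed.
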